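(* Suppose that $c_0/n\leq p\leq 1/2$ for some sufficiently large constant $c_0>0$. Then there exist constants $c_1,c_2,c_3,c_4>0$ such that with probability $1-o(1)$ as $n\to\infty$ $$c_1\sqrt{n/p}\leq\vartheta_{1/2}(G(n,p))\leq\vartheta(G(n,p))\leq\vartheta_2(G(n,p))\leq c_2\sqrt{n/p}$$ and $$c_3\sqrt{np}\leq\bar\vartheta_{1/2}(G(n,p))\leq\bar\vartheta(G(n,p))\leq\bar\vartheta_2(G(n,p))\leq c_4\sqrt{np}.$$ More precisely, $\Pr\big(c_3\sqrt{np}\leq\bar\vartheta_{1/2}(G(n,p))\leq\bar\vartheta(G(n,p))\leq\bar\vartheta_2(G(n,p))\big)\geq 1-\exp(-n)$.
   Context: $G(n,p)$ is the random graph on $V=\{1,\dots,n\}$ with each possible edge present independently with probability $p$. For a graph $G=(V,E)$ and a real $k>1$, an $n$-tuple $(v_1,\dots,v_n)$ of unit vectors in $\mathbb R^n$ is a vector $k$-coloring if $\langle v_i,v_j\rangle\leq-1/(k-1)$ for all $\{i,j\}\in E$; strict if $\langle v_i,v_j\rangle=-1/(k-1)$ for all $\{i,j\}\in E$; rigid if equality holds on all edges and $\langle v_i,v_j\rangle\geq-1/(k-1)$ for all non-adjacent $i\neq j$. $\bar\vartheta_{1/2}(G)$ (the vector chromatic number), $\bar\vartheta(G)$, $\bar\vartheta_2(G)$ denote the infimum of $k>1$ such that $G$ admits a vector, strict vector, resp. rigid vector $k$-coloring. With $\bar G$ the complement of $G$, $\vartheta_{1/2}(G)=\bar\vartheta_{1/2}(\bar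 G)$, $\vartheta(G)=\bar\vartheta(\bar G)$ (Lovász number), $\vartheta_2(G)=\bar\vartheta_2(\bar G)$. *)

(* Defs.v *)
From HB Require Import structures.
From mathcomp Require Import all_boot all_order all_algebra.
From mathcomp Require Import all_classical all_reals all_analysis.
Set Implicit Arguments. Unset Strict Implicit. Unset Printing Implicit Defensive.
Import Order.TTheory GRing.Theory Num.Theory.
Local Open Scope ring_scope.
Local Open Scope classical_set_scope.

(* A simple graph on V = 'I_n is given by its edge set: a set of 2-element
   subsets of 'I_n. *)
Definition graph (n : nat) := {set {set 'I_n}}.

Definition pairs (n : nat) : {set {set 'I_n}} := finset (fun e : {set 'I_n} => #|e| == 2%N).

Definition adj (n : nat) (E : graph n) (i j : 'I_n) : bool :=
  (i != j) && ((@finset.set1 _ i :|: @finset.set1 _ j)%SET \in E).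

Definition compl_graph (n : nat) (E : graph n) : graph n := pairs n :\: E.

Definition gnp_weight (R : realType) (n : nat) (p : R) (E : graph n) : R :=
  if E \subset pairs n then
    \prod_(e in pairs n) (if e \in E then p else 1 - p)
  else 0.

Definition gnp_prob (R : realType) (n : nat) (p : R) (A : pred (graph n)) : R :=
  \sum_(E : graph n | A E) gnp_weight p E.

Definition dotv (R : realType) (n : nat) (u w : 'rV[R]_n) : R := (u *m w^T) 0 0.

Definition unit_vectors (R : realType) (n : nat) (v : 'I_n -> 'rV[R]_n) : Prop :=
  forall i, dotv (v i) (v i) = 1.

Definition vector_coloring (R : realType) (n : nat) (E : graph n) (k : R)
    (v : 'I_n -> 'rV[R]_n) : Prop :=
  unit_vectors v /\
  forall i j, adj E i j -> dotv (v i) (v j) <= - (k - 1)^-1.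

Definition strict_vector_coloring (R : realType) (n : nat) (E : graph n) (k : R)
    (v : 'I_n -> 'rV[R]_n) : Prop :=
  unit_vectors v /\
  forall i j, adj E i j -> dotv (v i) (v j) = - (k - 1)^-1.

Definition rigid_vector_coloring (R : realType) (n : nat) (E : graph n) (k : R)
    (v : 'I_n -> 'rV[R]_n) : Prop :=
  unit_vectors v /\
  (forall i j, adj E i j -> dotv (v i) (v j) = - (k - 1)^-1) /\
  (forall i j, i != j -> ~~ adj E i j -> dotv (v i) (v j) >= - (k - 1)^-1).

Definition theta_bar_half (R : realType) (n : nat) (E : graph n) : R :=
  inf [set k : R | 1 < k /\ exists v, vector_coloring E k v].
Definition theta_bar (R : realType) (n : nat) (E : graph n) : R :=
  inf [set k : R | 1 < k /\ exists v, strict_vector_coloring E k v].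
Definition theta_bar_2 (R : realType) (n : nat) (E : graph n) : R :=
  inf [set k : R | 1 < k /\ exists v, rigid_vector_coloring E k v].

Definition theta_half (R : realType) (n : nat) (E : graph n) : R :=
  @theta_bar_half R n (compl_graph E).
Definition theta (R : realType) (n : nat) (E : graph n) : R :=
  @theta_bar R n (compl_graph E).
Definition theta_2 (R : realType) (n : nat) (E : graph n) : R :=
  @theta_bar_2 R n (compl_graph E).

(* Main.v *)
(* Write s = sqrt (n p) and let M be the adjacency matrix minus p, off the diagonal. With
   overwhelming probability the cut norm of M is O(n s), and by Grothendieck's inequality so is
   every sum of M i j <v i, v j> over unit vectors. A vector coloring makes all the inner products
   on the edges (or on the non-edges) negative, which gives both lower bounds.
   For the upper bounds, a spectral bound M <= K on a set of vertices yields a rigid coloring of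
   that set, and numbers of colors add up over a partition of the vertices. The spectral bound may
   fail at vertices of large degree, but SDP duality turns a cut norm bound on any vertex set into
   a spectral bound on all but a sixteenth of it. The cut norm, relative to the size of the set,
   decreases geometrically along this peeling, so the costs of the levels form a geometric series;
   the at most n / s vertices that remain at the end span a sparse graph, which is colored
   greedily, and in the complement each of them gets a color of its own. *)
Require Import Defs.
From HB Require Import structures.
From mathcomp Require Import all_boot all_order all_algebra.
From mathcomp Require Import all_classical all_reals all_analysis.
From mathcomp Require Import ring lra zify.
Import Order.TTheory GRing.Theory Num.Theory numFieldNormedType.Exports.
Local Open Scope ring_scope.

(** * The random graph *)

(** When [n p] stays bounded, a single vertex of maximal degree [d] already gives M a spectral norm
    of order sqrt d, which is not O(s). Cut norms hardly see a few such vertices, and a union bound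
    over signs controls them. The ratios 16 and 2 between the levels come from this union bound.
    Inside sets of size [m = n / 16 ^ l] there are exp (O ((l + 1) m)) cuts, each of variance O(p
    m^2), so their typical maximum is about m s sqrt (l + 1) / 4 ^ l; a bound of order m s / 2 ^ l
    leaves room for the factor sqrt (l + 1). The Chernoff exponent stays bounded only while s / 2 ^
    l dominates l + 1. This holds for 16 ^ l <= s, and there the peeling stops. On n / s vertices
    the expected degrees are at most p n / s = s, so greedy coloring is affordable, and n / s colors
    are just the target for the complement. Rigidity comes along because the certificates are
    matrices with zeros on the edges and nonnegative entries elsewhere, a property that survives
    rescaling and disjoint unions. *)

Definition gnp_E {R : realType} {n : nat} (p : R) (F : graph n -> R) : R :=
  \sum_(E : graph n) gnp_weight p E * F E.

(** Sets that are not pairs get weight 0 as edges and 1 as non-edges. The product then runs over all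
    subsets of the vertex set, and expectations of products factor by [bigA_distr]. *)
Lemma gnp_weightE {R : realType} {n : nat} (p : R) (E : graph n) :
  gnp_weight p E = \prod_e (if e \in E then (if e \in pairs n then p else 0)
                            else (if e \in pairs n then 1 - p else 1)).
Proof.
rewrite /gnp_weight; case: ifP => [/fintype.subsetP sE|/negbT/subsetPn[e eE ne]].
  rewrite [LHS]big_mkcond; apply: eq_bigr => e _.
  case: ifPn => ep; first by case: ifP.
  by case: ifP => // eE; rewrite sE in ep.
by rewrite (bigD1 e)//= eE (negPf ne) mul0r.
Qed.

Lemma gnp_weight_ge0 {R : realType} {n : nat} (p : R) (E : graph n) :
  0 <= p <= 1 -> 0 <= gnp_weight p E.
Proof.
move=> /andP[p0 p1]; rewrite gnp_weightE; apply: prodr_ge0 => e _.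
by do 2!case: ifP => //; rewrite subr_ge0.
Qed.

Lemma gnp_E_prod {R : realType} {n : nat} (p : R) (h : {set 'I_n} -> R) :
  gnp_E p (fun E => \prod_(e in pairs n) (if e \in E then h e else 1)) =
  \prod_(e in pairs n) (p * h e + (1 - p)).
Proof.
transitivity (\prod_(e : {set 'I_n}) ((if e \in pairs n then p * h e else 0) +
   (if e \in pairs n then 1 - p else 1))); last first.
  by rewrite [RHS]big_mkcond; apply: eq_bigr => e _; case: ifP => // _; rewrite add0r.
rewrite bigA_distr; apply: eq_bigr => E _.
rewrite gnp_weightE [X in _ * X]big_mkcond -big_split; apply: eq_bigr => e _ /=.
by do 2!case: ifP => _; rewrite ?mulr1 ?mul0r.
Qed.

Lemma gnp_E_le {R : realType} {n : nat} (p : R) (F G : graph n -> R) :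
  0 <= p <= 1 -> (forall E, F E <= G E) -> gnp_E p F <= gnp_E p G.
Proof.
by move=> p01 FG; apply: ler_sum => E _; apply: ler_wpM2l => //; exact: gnp_weight_ge0.
Qed.

Lemma gnp_E_sum {R : realType} {n : nat} (p : R) (I : Type) (r : seq I) (P : pred I)
    (F : I -> graph n -> R) :
  gnp_E p (fun E => \sum_(i <- r | P i) F i E) = \sum_(i <- r | P i) gnp_E p (F i).
Proof.
by rewrite exchange_big /=; apply: eq_bigr => E _; rewrite mulr_sumr.
Qed.

Lemma gnp_EZ {R : realType} {n : nat} (p : R) (a : R) (F : graph n -> R) :
  gnp_E p (fun E => a * F E) = a * gnp_E p F.
Proof. by rewrite mulr_sumr; apply: eq_bigr => E _; rewrite mulrCA. Qed.

Lemma gnp_E1 {R : realType} {n : nat} (p : R) : gnp_E p (fun _ : graph n => 1) = 1.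
Proof.
rewrite -[LHS](_ : gnp_E p (fun E : graph n =>
    \prod_(e in pairs n) (if e \in E then 1 else 1)) = _); last first.
  by apply: eq_bigr => E _; rewrite big1 // => e _; case: ifP.
by rewrite gnp_E_prod big1 // => e _; rewrite mulr1 subrKC.
Qed.

Lemma gnp_probE {R : realType} {n : nat} (p : R) (A : pred (graph n)) :
  gnp_prob p A = gnp_E p (fun E => (A E)%:R).
Proof.
rewrite /gnp_prob big_mkcond; apply: eq_bigr => E _.
by case: (A E); rewrite ?mulr1 ?mulr0.
Qed.

Lemma gnp_prob_le1 {R : realType} {n : nat} (p : R) (A : pred (graph n)) :
  0 <= p <= 1 -> gnp_prob p A <= 1.
Proof.
move=> p01; rewrite gnp_probE -[leRHS](@gnp_E1 R n p); apply: gnp_E_le => // E.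
by case: (A E).
Qed.

(** Markov's inequality for the failure event. A union bound amounts to taking for [F] a sum of
    exponential moments, one of which is at least 1 at each failure. *)
Lemma gnp_prob_ge {R : realType} {n : nat} (p : R) (A : pred (graph n)) (F : graph n -> R) :
  0 <= p <= 1 -> (forall E, 0 <= F E) -> (forall E : graph n, E \subset pairs n -> ~~ A E -> 1 <= F E) ->
  1 - gnp_E p F <= gnp_prob p A.
Proof.
move=> p01 F0 F1; rewrite gnp_probE lerBlDr -[leLHS](@gnp_E1 R n p) -big_split /=.
apply: ler_sum => E _; rewrite -mulrDr.
have [sE|nE] := boolP (E \subset pairs n); last by rewrite /gnp_weight (negPf nE) !mul0r.
apply: ler_wpM2l; first exact: gnp_weight_ge0.
have := F1 E sE; have := F0 E; case: (A E) => /= [*|? /(_ isT)]; lra.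
Qed.

Lemma gnp_mgf {R : realType} {n : nat} (p : R) (c : {set 'I_n} -> R) :
  0 <= p <= 1 ->
  gnp_E p (fun E => expR (\sum_(e in pairs n) c e * (e \in E)%:R)) <=
  expR (p * \sum_(e in pairs n) (expR (c e) - 1)).
Proof.
move=> /andP[p0 p1].
rewrite -[leLHS](_ : gnp_E p (fun E : graph n =>
    \prod_(e in pairs n) (if e \in E then expR (c e) else 1)) = _); last first.
  apply: eq_bigr => E _; congr (_ * _); rewrite expR_sum; apply: eq_bigr => e _.
  by case: ifP; rewrite ?mulr1 ?mulr0 ?expR0.
rewrite gnp_E_prod mulr_sumr expR_sum; apply: ler_prod => e _.
have c0 := expR_gt0 (c e); apply/andP; split.
  by apply: addr_ge0; [apply: mulr_ge0 => //; exact: ltW|rewrite subr_ge0].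
apply: le_trans (expR_ge1Dx _); lra.
Qed.

Lemma sum_expn_card {R : comPzRingType} {T : finType} (a : R) :
  \sum_(S : {set T}) a ^+ #|S| = (1 + a) ^+ #|T|.
Proof.
rewrite -prodr_const addrC bigA_distr; apply: eq_bigr => S _.
by rewrite -big_mkcond prodr_const.
Qed.

Lemma sum_ordered_pairs {R : nmodType} {n : nat} (G : 'I_n -> 'I_n -> R) :
  \sum_i \sum_(j | i != j) G i j = \sum_(e in pairs n)
    \sum_(ij : 'I_n * 'I_n | (ij.1 != ij.2) && ([set ij.1; ij.2]%SET == e)) G ij.1 ij.2.
Proof.
rewrite pair_big_dep /=.
rewrite (partition_big (fun ij : 'I_n * 'I_n => [set ij.1; ij.2]%SET) (mem (pairs n))) //=.
by move=> [i j] /= ij; rewrite /pairs inE cards2 ij.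
Qed.

Lemma sum_edge_orientations {R : nmodType} {n : nat} (G : 'I_n -> 'I_n -> R) (a b : 'I_n) :
  a != b ->
  \sum_(ij : 'I_n * 'I_n | (ij.1 != ij.2) && ([set ij.1; ij.2]%SET == [set a; b]%SET))
     G ij.1 ij.2 = G a b + G b a.
Proof.
move=> ab; rewrite (bigD1 (a, b)) /=; last by rewrite ab eqxx.
congr (_ + _); rewrite (big_pred1 (b, a)) // => -[i j] /=.
rewrite !xpair_eqE; apply/andP/andP => [[/andP[ij /eqP/setP e] ne]|[/eqP-> /eqP->]].
  have := e i; have := e j; rewrite !inE !eqxx orbT /= => /esym/orP hj /esym/orP[] /eqP ?; subst i.
    by case: hj => /eqP ?; subst j; move: ij ne; rewrite !eqxx.
  by case: hj => /eqP ?; subst j; move: ij; rewrite !eqxx.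
by rewrite eq_sym ab finset.setUC eqxx negb_and ab ?orbT.
Qed.

(** * Grothendieck's inequality *)

Definition rsign {R : pzRingType} (b : bool) : R := if b then 1 else -1.

Definition flip {T : finType} (t : T) (w : {ffun T -> bool}) : {ffun T -> bool} :=
  [ffun s => if s == t then ~~ w s else w s].

(** The sum runs over a sequence so that moments can be computed by induction, the sign of the new
    head being independent of the tail. *)
Definition rademacher {R : pzRingType} {T : finType} (r : seq T) (u : T -> R)
    (w : {ffun T -> bool}) : R := \sum_(t <- r) rsign (w t) * u t.

Definition avg {R : fieldType} {W : finType} (F : W -> R) : R := (\sum_w F w) / #|W|%:R.

Lemma avgD {R : fieldType} {W : finType} (F G : W -> R) :
  avg (fun w => F w + G w) = avg F + avg G.
Proof. by rewrite /avg big_split mulrDl. Qed.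

Lemma avgZ {R : fieldType} {W : finType} (a : R) (F : W -> R) :
  avg (fun w => a * F w) = a * avg F.
Proof. by rewrite /avg -mulr_sumr mulrA. Qed.

Lemma avg_sum {R : fieldType} {W I : finType} (F : I -> W -> R) :
  avg (fun w => \sum_i F i w) = \sum_i avg (F i).
Proof. by rewrite /avg exchange_big mulr_suml. Qed.

Lemma avg_cst {R : numFieldType} {W : finType} (w0 : W) (a : R) : avg (fun _ : W => a) = a.
Proof.
rewrite /avg sumr_const -[a *+ _]mulr_natr mulfK // pnatr_eq0 -lt0n.
by apply/card_gt0P; exists w0.
Qed.

Lemma eq_avg {R : fieldType} {W : finType} (F G : W -> R) : F =1 G -> avg F = avg G.
Proof. by move=> FG; congr (_ / _); exact: eq_bigr. Qed.

Lemma le_avg {R : numFieldType} {W : finType} (F G : W -> R) :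
  (forall w, F w <= G w) -> avg F <= avg G.
Proof. by move=> FG; apply: ler_wpM2r; rewrite ?invr_ge0 ?ler0n //; exact: ler_sum. Qed.

Lemma flipK {T : finType} (t : T) : involutive (flip t).
Proof. by move=> w; apply/ffunP => s; rewrite !ffunE; case: eqP; rewrite ?negbK. Qed.

(** Flipping the sign at [t] permutes the cube and negates the summand. This replaces independence
    in the moment computations. *)
Lemma avg_flip_odd {R : realFieldType} {T : finType} (t : T) (F : {ffun T -> bool} -> R) :
  (forall w, F (flip t w) = F w) ->
  avg (fun w : {ffun T -> bool} => rsign (w t) * F w) = 0.
Proof.
move=> Ff; rewrite /avg; set s := \sum_w _; suff e : s = - s.
  have -> : s = 0 by lra.
  exact: mul0r.
rewrite [LHS](reindex_inj (inv_inj (flipK t))) -sumrN; apply: eq_bigr => w _.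
rewrite Ff -mulNr; congr (_ * _); rewrite ffunE eqxx /rsign; case: (w t) => //=.
by rewrite opprK.
Qed.

Lemma rademacher_flip {R : pzRingType} {T : finType} (r : seq T) (u : T -> R) t w :
  t \notin r -> rademacher r u (flip t w) = rademacher r u w.
Proof.
move=> tr; apply: eq_big_seq => s sr; rewrite ffunE; case: eqP => // st.
by rewrite -st sr in tr.
Qed.

Lemma rsign_sqr {R : pzRingType} b : rsign b * rsign b = 1 :> R.
Proof. by case: b; rewrite /= ?mulr1 ?mulrNN ?mulr1. Qed.

Lemma rademacher_cov {R : realFieldType} {T : finType} (r : seq T) (u v : T -> R) :
  uniq r -> avg (fun w => rademacher r u w * rademacher r v w) = \sum_(t <- r) u t * v t.
Proof.
elim: r => [_|t r IH /= /andP[tr /IH {}IH]].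
  by rewrite big_nil -[RHS](@avg_cst R {ffun T -> bool} [ffun=> true]); apply: eq_avg => w;
    rewrite /rademacher !big_nil mul0r.
rewrite big_cons -IH -[u t * v t](@avg_cst R {ffun T -> bool} [ffun=> true]).
rewrite -[RHS]addr0 -(@avg_flip_odd R T t (fun w => u t * rademacher r v w + rademacher r u w * v t)).
  rewrite -!avgD; apply: eq_avg => w; rewrite /rademacher !big_cons -!/(rademacher _ _ _).
  have := @rsign_sqr R (w t); set e := rsign _ => ee.
  rewrite mulrDl !mulrDr mulrACA ee mul1r; ring.
by move=> w; rewrite !rademacher_flip.
Qed.

(** Adding a coordinate [a] to a sum of second moment [s] adds [6 a^2 s + a^4] to the fourth moment,
    and [6 a^2 s + 3 a^4] to the right-hand side. *)
Lemma rademacher_moment4 {R : realFieldType} {T : finType} (r : seq T) (u : T -> R) :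
  uniq r -> avg (fun w => rademacher r u w ^+ 4) <= 3 * (\sum_(t <- r) u t ^+ 2) ^+ 2.
Proof.
elim: r => [_|t r IH /= /andP[tr ur]].
  rewrite -[leRHS](@avg_cst R {ffun T -> bool} [ffun=> true]); apply: le_avg => w.
  by rewrite /rademacher !big_nil !expr0n /= mulr0.
rewrite big_cons; move: {IH}(IH ur); set s := (\sum_(_ <- _) _).
have sE : avg (fun w => rademacher r u w ^+ 2) = s.
  by rewrite /s (eq_bigr (fun t => u t * u t)) // -rademacher_cov.
have -> : avg (fun w => rademacher (t :: r) u w ^+ 4) =
  avg (fun w => rademacher r u w ^+ 4) + 6 * u t ^+ 2 * s + u t ^+ 4.
  rewrite -sE -avgZ -[u t ^+ 4](@avg_cst R {ffun T -> bool} [ffun=> true]).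
  rewrite -[RHS]addr0 -(@avg_flip_odd R T t (fun w => 4 * u t * rademacher r u w ^+ 3 +
     4 * u t ^+ 3 * rademacher r u w)).
    rewrite -!avgD; apply: eq_avg => w; rewrite /rademacher !big_cons -!/(rademacher _ _ _).
    have := @rsign_sqr R (w t); set e := rsign _ => ee; set S := rademacher _ _ _.
    have e2 : e ^+ 2 = 1 by [].
    have e3 : e ^+ 3 = e by rewrite exprS e2 mulr1.
    have e4 : e ^+ 4 = 1 by rewrite exprS e3.
    transitivity (e ^+ 4 * u t ^+ 4 + 4 * (e ^+ 3 * u t ^+ 3 * S) + 6 * (e ^+ 2 * u t ^+ 2 * S ^+ 2)
      + 4 * (e * u t * S ^+ 3) + S ^+ 4); first by ring.
    rewrite e4 e3 e2; ring.
  by move=> w; rewrite !rademacher_flip.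
have := sqr_ge0 (u t); have -> : u t ^+ 4 = (u t ^+ 2) ^+ 2 by rewrite -exprM.
set a := u t ^+ 2 => a0 IH; have : 0 <= a ^+ 2 := sqr_ge0 _; nra.
Qed.

Lemma rademacher_tail {R : realFieldType} {T : finType} (u : T -> R) (M : R) :
  0 < M -> \sum_t u t ^+ 2 <= 1 ->
  avg (fun w => (if `|rademacher (enum T) u w| <= M then 0 else rademacher (enum T) u w) ^+ 2)
    <= 3 / M ^+ 2.
Proof.
move=> M0 u1; rewrite -big_enum in u1.
have M2 : 0 < M ^+ 2 by rewrite exprn_gt0.
apply: (@le_trans _ _ (avg (fun w => (M ^+ 2)^-1 * rademacher (enum T) u w ^+ 4))).
  apply: le_avg => w; set x := rademacher _ _ _; case: ifPn => [_|].
    by rewrite expr0n /= mulr_ge0 ?invr_ge0 ?exprn_even_ge0 // ltW.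
  rewrite -ltNge => Mx; rewrite ler_pdivlMl // (_ : x ^+ 4 = x ^+ 2 * x ^+ 2); last by rewrite -exprD.
  apply: ler_wpM2r; first exact: sqr_ge0.
  by rewrite -[x ^+ 2]real_normK ?num_real // lerXn2r ?nnegrE ?normr_ge0 // ltW.
rewrite avgZ [leRHS]mulrC ler_pM2l ?invr_gt0 //.
apply: le_trans (rademacher_moment4 _ _ (enum_uniq T)) _.
rewrite -[leRHS]mulr1 ler_pM2l // exprn_ile1 //.
by apply: sumr_ge0 => t _; exact: sqr_ge0.
Qed.

(** For fixed [x] the form is linear in [y], so it increases when [y] is replaced by [c] times the
    signs [b] of its coefficients; then likewise for [x]. *)
Lemma bilinear_sign_bound {R : realDomainType} {n : nat} (M : 'I_n -> 'I_n -> R) (a c : R) :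
  0 <= c ->
  (forall x y : 'I_n -> bool, \sum_i \sum_j M i j * rsign (x i) * rsign (y j) <= a) ->
  forall x y : 'I_n -> R, (forall i, `|x i| <= c) -> (forall i, `|y i| <= c) ->
  \sum_i \sum_j M i j * x i * y j <= c * c * a.
Proof.
move=> c0 Ma.
have sg (x k : R) : `|x| <= c -> x * k <= c * (rsign (0 <= k) * k).
  move=> xc; apply: le_trans (ler_norm _) _; rewrite normrM.
  suff -> : rsign (0 <= k) * k = `|k| by apply: ler_wpM2r.
  by case: ger0P => _ /=; rewrite ?mul1r ?mulN1r.
move=> x y xc yc.
pose h j := \sum_i M i j * x i; pose b j := 0 <= h j.
pose g i := \sum_j M i j * rsign (b j); pose d i := 0 <= g i.
apply: (@le_trans _ _ (c * \sum_i \sum_j M i j * x i * rsign (b j))).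
  rewrite exchange_big [in leRHS]exchange_big mulr_sumr; apply: ler_sum => j _ /=.
  rewrite -!mulr_suml mulrC [X in c * X]mulrC; exact: sg.
rewrite -mulrA; apply: ler_wpM2l => //.
apply: (@le_trans _ _ (c * \sum_i \sum_j M i j * rsign (d i) * rsign (b j))); last first.
  by apply: ler_wpM2l => //; exact: Ma.
rewrite mulr_sumr; apply: ler_sum => i _ /=.
under eq_bigr do rewrite mulrAC; rewrite -mulr_suml.
under [in leRHS]eq_bigr do rewrite mulrAC; rewrite -mulr_suml.
rewrite mulrC [X in c * X]mulrC; exact: sg.
Qed.

(* With [b] the supremum over the Hilbert unit ball, replace vectors by Rademacher sums truncated
   at level 7: the truncated parts contribute at most [49 * a] and the tails, of norm at most 1/4,
   at most [b / 4] each, so [b <= 49 * a + b / 2]. *)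
Theorem grothendieck {R : realType} {n : nat} (M : 'I_n -> 'I_n -> R) (a : R) :
  (forall x y : 'I_n -> bool, \sum_i \sum_j M i j * rsign (x i) * rsign (y j) <= a) ->
  forall (T : finType) (u v : 'I_n -> T -> R),
  (forall i, \sum_t u i t ^+ 2 <= 1) -> (forall i, \sum_t v i t ^+ 2 <= 1) ->
  \sum_i \sum_j M i j * \sum_t u i t * v j t <= 98 * a.
Proof.
move=> Ma.
pose inball (T : finType) (u : 'I_n -> T -> R) := forall i, \sum_t u i t ^+ 2 <= 1.
pose B : set R := fun b => exists (T : finType) (u v : 'I_n -> T -> R),
  [/\ inball T u, inball T v & b = \sum_i \sum_j M i j * \sum_t u i t * v j t].
(* Finiteness of the supremum is what allows [sup B / 2] to be absorbed below. *)
have Bub : has_ubound B.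
  exists (\sum_i \sum_j `|M i j|) => b [T [u [v [u1 v1 ->]]]].
  apply: ler_sum => i _; apply: ler_sum => j _.
  apply: le_trans (ler_norm _) _; rewrite normrM -[leRHS]mulr1; apply: ler_wpM2l => //.
  apply: le_trans (ler_norm_sum _ _ _) _.
  apply: (@le_trans _ _ (\sum_t (2^-1 * u i t ^+ 2 + 2^-1 * v j t ^+ 2))).
    apply: ler_sum => t _; rewrite normrM -[u i t ^+ 2]real_normK ?num_real //.
    rewrite -[v j t ^+ 2]real_normK ?num_real //.
    have := sqr_ge0 (`|u i t| - `|v j t|); nra.
  rewrite big_split -!mulr_sumr /=; have := u1 i; have := v1 j; lra.
have Bsup : has_sup B.
  split=> //; exists 0; exists 'I_0, (fun _ _ => 0), (fun _ _ => 0); split.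
  - by move=> i; rewrite big_ord0.
  - by move=> i; rewrite big_ord0.
  - by rewrite big1 // => i _; rewrite big1 // => j _; rewrite big_ord0 mulr0.
have Ble (T : finType) u v : inball T u -> inball T v ->
    \sum_i \sum_j M i j * \sum_t u i t * v j t <= sup B.
  by move=> u1 v1; apply: ub_le_sup => //; exists T, u, v.
suff supB : sup B <= 98 * a by move=> T u v u1 v1; exact: le_trans (Ble _ _ _ u1 v1) supB.
suff : sup B <= 49 * a + sup B / 2 by lra.
apply: ge_sup; first by case: Bsup.
move=> _ [T [u [v [u1 v1 ->]]]].
pose W := {ffun T -> bool}; pose w0 : W := [ffun=> true].
pose X (u : 'I_n -> T -> R) i w := rademacher (enum T) (u i) w.
pose lo (x : R) := if `|x| <= 7 then x else 0.
pose hi (x : R) := if `|x| <= 7 then 0 else x.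
have lohi x : x = lo x + hi x by rewrite /lo /hi; case: ifP; rewrite ?addr0 ?add0r.
have cov x y i j : \sum_t x i t * y j t = avg (fun w => X x i w * X y j w).
  by rewrite rademacher_cov ?enum_uniq // big_enum.
have normX x : inball T x -> forall i, avg (fun w => X x i w ^+ 2) <= 1.
  by move=> x1 i; rewrite -[X in X <= _](cov x x i i); exact: x1.
have normlo x : inball T x -> forall i, avg (fun w => lo (X x i w) ^+ 2) <= 1.
  move=> x1 i; apply: le_trans (normX _ x1 i); apply: le_avg => w.
  by rewrite /lo; case: ifP => // _; rewrite expr0n /= sqr_ge0.
(* The level 7 comes from here: the squared tail has mean at most [3 / 49 < 1 / 16]. *)
have normhi x : inball T x -> forall i, avg (fun w => (4 * hi (X x i w)) ^+ 2) <= 1.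
  move=> x1 i; have := @rademacher_tail R T (x i) 7 (ltr0n _ _) (x1 i).
  rewrite (eq_avg _ _ (fun w => exprMn _ _ _)) avgZ /hi /X; lra.
have Bavg (F G : 'I_n -> W -> R) : (forall i, avg (fun w => F i w ^+ 2) <= 1) ->
    (forall i, avg (fun w => G i w ^+ 2) <= 1) ->
    \sum_i \sum_j M i j * avg (fun w => F i w * G j w) <= sup B.
  (* This scaling turns the average over [W] into a plain inner product. *)
  pose c : R := Num.sqrt (#|W|%:R^-1).
  have cc : c * c = #|W|%:R^-1 by rewrite -expr2 sqr_sqrtr // invr_ge0 ler0n.
  have dotc (F' G' : W -> R) : \sum_w (c * F' w) * (c * G' w) = avg (fun w => F' w * G' w).
    by rewrite /avg mulrC -cc mulr_sumr; apply: eq_bigr => w _; rewrite mulrACA.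
  move=> F1 G1; have := Ble W (fun i w => c * F i w) (fun i w => c * G i w).
  under eq_bigr do under eq_bigr do rewrite dotc; apply => i.
    by have := F1 i; rewrite -[X in X <= _ -> _]dotc.
  by have := G1 i; rewrite -[X in X <= _ -> _]dotc.
(* The product of two sums is split as lo lo + hi lo + (lo + hi) hi; keeping the last factor whole
   leaves only two tail terms. *)
have -> : \sum_i \sum_j M i j * \sum_t u i t * v j t =
   \sum_i \sum_j M i j * avg (fun w => lo (X u i w) * lo (X v j w)) +
   4^-1 * (\sum_i \sum_j M i j * avg (fun w => (4 * hi (X u i w)) * lo (X v j w))) +
   4^-1 * (\sum_i \sum_j M i j * avg (fun w => X u i w * (4 * hi (X v j w)))).
  rewrite !mulr_sumr -!big_split; apply: eq_bigr => i _; rewrite !mulr_sumr -!big_split.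
  apply: eq_bigr => j _ /=; rewrite ![4^-1 * (M i j * _)]mulrCA -!mulrDr cov; congr (_ * _).
  rewrite -!avgZ -!avgD; apply: eq_avg => w; have := lohi (X u i w); have := lohi (X v j w).
  move: (lo _) (hi _) (lo _) (hi _) => lv hv lu hu -> ->; lra.
have h1 := Bavg _ _ (normhi _ u1) (normlo _ v1).
have h2 := Bavg _ _ (normX _ u1) (normhi _ v1).
suff : \sum_i \sum_j M i j * avg (fun w => lo (X u i w) * lo (X v j w)) <= 49 * a by lra.
rewrite -[leRHS](@avg_cst R W w0).
have -> : \sum_i \sum_j M i j * avg (fun w => lo (X u i w) * lo (X v j w)) =
    avg (fun w => \sum_i \sum_j M i j * lo (X u i w) * lo (X v j w)).
  rewrite avg_sum; apply: eq_bigr => i _; rewrite avg_sum; apply: eq_bigr => j _.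
  by rewrite -avgZ; apply: eq_avg => w; rewrite mulrA.
apply: le_avg => w; rewrite (_ : 49 = 7 * 7); last by ring.
have lo7 x : `|lo x| <= 7 by rewrite /lo; case: ifP; rewrite ?normr0.
exact: bilinear_sign_bound.
Qed.

(** * Duality for the cut semidefinite program *)

(** Flattened to row vectors, the configurations form a closed subset of a cube, hence a compact
    set; dimension [m.+1] makes it nonempty. *)
Lemma exists_max_unit_vectors {R : realType} {n m : nat} (M : 'I_n -> 'I_n -> R) :
  exists2 v : 'I_n -> 'I_m.+1 -> R, (forall i, \sum_k v i k ^+ 2 = 1) &
  forall u : 'I_n -> 'I_m.+1 -> R, (forall i, \sum_k u i k ^+ 2 = 1) ->
  \sum_i \sum_j M i j * (\sum_k u i k * u j k) <= \sum_i \sum_j M i j * (\sum_k v i k * v j k).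
Proof.
pose c (w : 'rV[R]_(n * m.+1)) i k := w ord0 (mxvec_index i k).
have cc i k : continuous (fun w => c w i k) by exact: coord_continuous.
have sumC (T : topologicalType) (I : finType) (F : I -> T -> R) :
    (forall i, continuous (F i)) -> continuous (fun w => \sum_i F i w).
  by move=> Fc; apply: (continuous_big add_continuous) => i _; exact: Fc.
have mulC (T : topologicalType) (f g : T -> R) :
    continuous f -> continuous g -> continuous (fun w => f w * g w).
  by move=> fc gc w; apply: cvgM; [exact: fc|exact: gc].
pose A : set 'rV[R]_(n * m.+1) := fun w => forall i, \sum_k c w i k * c w i k = 1.
pose vec (u : 'I_n -> 'I_m.+1 -> R) : 'rV[R]_(n * m.+1) := mxvec (\matrix_(i, k) u i k).
have cvec u i k : c (vec u) i k = u i k by rewrite /c /vec mxvecE mxE.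
have Avec u : (forall i, \sum_k u i k ^+ 2 = 1) -> A (vec u).
  by move=> u1 i; rewrite -[RHS](u1 i); apply: eq_bigr => k _; rewrite cvec expr2.
have A0 : (A !=set0)%classic.
  exists (vec (fun _ k => (k == ord0)%:R)); apply: Avec => i.
  by rewrite (bigD1 ord0) //= expr1n big1 ?addr0 // => k /negPf ->; rewrite expr0n.
have Aclosed : closed A.
  have -> : A = (\bigcap_(i in setT) ((fun w => \sum_k c w i k * c w i k) @^-1` [set 1]))%classic.
    by apply/seteqP; split => [w Aw i _|w Aw i]; [exact: Aw|exact: (Aw i I)].
  apply: closed_bigI => i _; apply: preimage_closed; last exact: closed_eq.
  by move=> w _; apply: (sumC) => k; apply: mulC; exact: cc.
have Acompact : compact A.
  have cube : compact [set w : 'rV[R]_(n * m.+1) | forall q, `[-1, 1]%classic (w ord0 q)]%classic.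
    by apply: (@rV_compact R _ (fun _ => `[-1, 1]%classic)) => q; exact: segment_compact.
  apply: (subclosed_compact Aclosed cube).
  move=> w Aw /= q; case/mxvec_indexP: q => i k; rewrite in_itv /= -ler_norml.
  rewrite -(@ler_pXn2r _ 2) ?nnegrE // expr1n real_normK ?num_real // expr2 -[leRHS](Aw i).
  rewrite (bigD1 k) //= lerDl; apply: sumr_ge0 => l _; rewrite -expr2; exact: sqr_ge0.
have fC : continuous (fun w => \sum_i \sum_j M i j * (\sum_k c w i k * c w j k)).
  apply: (sumC) => i; apply: (sumC) => j; apply: (mulC _ (fun=> M i j)); first exact: cst_continuous.
  by apply: (sumC) => k; apply: mulC; exact: cc.
have [w Aw wmax] := compact_EVT_max A0 Acompact (continuous_subspaceT fC).
exists (c w) => [i|u u1].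
  by move: Aw; rewrite inE => /(_ i) <-; apply: eq_bigr => k _; rewrite expr2.
have := wmax (vec u); rewrite inE => /(_ (Avec _ u1)); apply: le_trans.
apply: ler_sum => i _; apply: ler_sum => j _; under [in leRHS]eq_bigr do rewrite !cvec.
exact: lexx.
Qed.

Lemma exists_orthogonal_unit {R : rcfType} {n : nat} (v : 'I_n -> 'I_n.+1 -> R) :
  exists2 e : 'I_n.+1 -> R, \sum_k e k ^+ 2 = 1 & forall i, \sum_k v i k * e k = 0.
Proof.
pose V : 'M[R]_(n, n.+1) := \matrix_(i, k) v i k.
have /rowV0Pn[w /sub_kermxP wV w0] : kermx V^T != 0.
  rewrite -mxrank_eq0 mxrank_ker mxrank_tr -lt0n subn_gt0 ltnS; exact: rank_leq_row.
pose s := \sum_k w 0 k ^+ 2.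
have s0 : 0 < s.
  have [k wk] : exists k, w 0 k != 0.
    by apply/existsP; apply: contraR w0; rewrite negb_exists => /forallP w0;
      apply/eqP/rowP => k; apply/eqP; rewrite mxE; have := w0 k; rewrite negbK.
  rewrite /s (bigD1 k) //= ltr_wpDr ?exprn_even_gt0 //.
  by apply: sumr_ge0 => l _; exact: sqr_ge0.
exists (fun k => w 0 k / Num.sqrt s) => [|i].
  under eq_bigr do rewrite exprMn exprVn sqr_sqrtr ?ltW //.
  by rewrite -mulr_suml divff // gt_eqF.
under eq_bigr do rewrite mulrA; rewrite -mulr_suml.
have /rowP/(_ i) := wV; rewrite !mxE => wVi.
rewrite (_ : \sum_k _ = 0) ?mul0r // -[RHS]wVi; apply: eq_bigr => k _.
by rewrite !mxE mulrC.
Qed.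

(* Burer-Monteiro: in dimension [n + 1] a maximizing configuration leaves a free direction [e].
   Tilting each [v i] towards [e] by the angle [eps * x i] changes the objective, to second
   order, by [eps ^ 2] times the difference of the two sides of the last inequality. *)
Theorem sdp_duality {R : realType} {n : nat} (M : 'I_n -> 'I_n -> R) (B : R) :
  (forall i j, M i j = M j i) -> (forall i, M i i = 0) ->
  (forall u : 'I_n -> 'I_n.+1 -> R, (forall i, \sum_k u i k ^+ 2 = 1) ->
     \sum_i \sum_j M i j * (\sum_k u i k * u j k) <= B) ->
  exists d : 'I_n -> R, [/\ forall i, 0 <= d i, \sum_i d i <= B &
    forall x : 'I_n -> R, \sum_i \sum_j M i j * x i * x j <= \sum_i d i * x i ^+ 2].
Proof.
move=> Msym M0 MB; have [v v1 vmax] := @exists_max_unit_vectors R n n M.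
have [e e1 ve] := exists_orthogonal_unit v.
pose G i j := M i j * (\sum_k v i k * v j k).
have Gsym i j : G i j = G j i.
  by rewrite /G Msym; congr (_ * _); apply: eq_bigr => k _; rewrite mulrC.
(* [d i] is the Lagrange multiplier of the constraint on the length of [v i]; the sum of all [d i]
   is the maximal value of the objective. *)
pose d i := \sum_j G i j; exists d.
have main (x : 'I_n -> R) : \sum_i \sum_j M i j * x i * x j <= \sum_i d i * x i ^+ 2.
  set K := \sum_i \sum_j `|G i j| * (x i ^+ 2 + x j ^+ 2) ^+ 2.
  have K0 : 0 <= K.
    by apply: sumr_ge0 => i _; apply: sumr_ge0 => j _; rewrite mulr_ge0 ?sqr_ge0.
  set X := \sum_i x i ^+ 2; have xX i : x i ^+ 2 <= X.
    by rewrite /X (bigD1 i) //= lerDl; apply: sumr_ge0 => j _; exact: sqr_ge0.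
  have X0 : 0 <= X by apply: sumr_ge0 => j _; exact: sqr_ge0.
  suff step t : 0 < t -> t * (1 + X) <= 1 ->
      \sum_i \sum_j M i j * x i * x j <= \sum_i d i * x i ^+ 2 + t * K.
    apply/ler_addgt0Pr => eps eps0; pose t := Num.min (1 + X)^-1 (eps / (1 + K)).
    have t0 : 0 < t by rewrite lt_min invr_gt0 divr_gt0 ?andbT; lra.
    have tX : t * (1 + X) <= 1 by rewrite -ler_pdivlMr ?div1r ?ge_min ?lexx //; lra.
    apply: le_trans (step t t0 tX) _.
    rewrite lerD2l; apply: (@le_trans _ _ (t * (1 + K))); first by rewrite ler_pM2l //; lra.
    by rewrite -ler_pdivlMr ?ge_min ?lexx ?orbT //; lra.
  (* Here [t] is the square of the small parameter: [c i] is the cosine of the tilt of [v i], its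
     sine is [sqrt t * x i], and [tX] keeps the radicand in [0, 1]. *)
  move=> t0 tX; pose c i := Num.sqrt (1 - t * x i ^+ 2).
  have txi i : 0 <= t * x i ^+ 2 <= 1.
    apply/andP; split; first by rewrite mulr_ge0 ?sqr_ge0 // ltW.
    apply: le_trans tX; rewrite ler_pM2l //.
    by have := xX i; lra.
  have c2 i : c i ^+ 2 = 1 - t * x i ^+ 2.
    by rewrite sqr_sqrtr // subr_ge0; case/andP: (txi i).
  have c01 i : 0 <= c i <= 1.
    rewrite sqrtr_ge0 /= -[leRHS]sqrtr1 ler_sqrt //; case/andP: (txi i) => ? _; lra.
  pose s := Num.sqrt t; have s2 : s ^+ 2 = t by rewrite sqr_sqrtr // ltW.
  have tilt i j : \sum_k (c i * v i k + s * x i * e k) * (c j * v j k + s * x j * e k) =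
      c i * c j * (\sum_k v i k * v j k) + t * x i * x j.
    transitivity (c i * c j * (\sum_k v i k * v j k) + c i * s * x j * (\sum_k v i k * e k) +
      c j * s * x i * (\sum_k v j k * e k) + s ^+ 2 * x i * x j * (\sum_k e k ^+ 2)).
      rewrite !mulr_sumr -!big_split; apply: eq_bigr => k _ /=; ring.
    by rewrite !ve e1 s2; ring.
  have /vmax : forall i, \sum_k (c i * v i k + s * x i * e k) ^+ 2 = 1.
    move=> i; under eq_bigr do rewrite expr2; rewrite tilt.
    under eq_bigr do rewrite -expr2; rewrite v1 -expr2 c2; ring.
  under eq_bigr do under eq_bigr do rewrite tilt.
  set q := \sum_i \sum_j M i j * x i * x j => objle.
  have dE : \sum_i \sum_j G i j * (x i ^+ 2 + x j ^+ 2) = 2 * \sum_i d i * x i ^+ 2.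
    transitivity (\sum_i \sum_j G i j * x i ^+ 2 + \sum_i \sum_j G i j * x j ^+ 2).
      rewrite -big_split; apply: eq_bigr => i _; rewrite -big_split; apply: eq_bigr => j _ /=; ring.
    rewrite mulr_natl mulr2n; congr (_ + _); last rewrite exchange_big /=.
      by apply: eq_bigr => i _; rewrite mulr_suml.
    apply: eq_bigr => i _; rewrite mulr_suml; apply: eq_bigr => j _; by rewrite Gsym.
  (* By [2 c_i c_j = c_i^2 + c_j^2 - (c_i - c_j)^2] everything except the last square is affine in
     [t]. *)
  have objE : 2 * \sum_i \sum_j M i j * (c i * c j * (\sum_k v i k * v j k) + t * x i * x j) =
      2 * \sum_i \sum_j G i j - t * (\sum_i \sum_j G i j * (x i ^+ 2 + x j ^+ 2))
      - \sum_i \sum_j G i j * (c i - c j) ^+ 2 + 2 * t * q.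
    rewrite /q !mulr_sumr -!sumrN -!big_split; apply: eq_bigr => i _ /=.
    rewrite !mulr_sumr -!sumrN -!big_split; apply: eq_bigr => j _ /=.
    rewrite /G; move: (c2 i) (c2 j); set m := \sum_k _ => ci cj.
    have -> : (c i - c j) ^+ 2 = (1 - t * x i ^+ 2) + (1 - t * x j ^+ 2) - 2 * c i * c j.
      by rewrite -ci -cj; ring.
    ring.
  (* Since [1 - y <= sqrt (1 - y) <= 1], the difference of two cosines is of order [t] and its
     square is negligible. *)
  have remainder : \sum_i \sum_j G i j * (c i - c j) ^+ 2 <= t ^+ 2 * K.
    rewrite /K mulr_sumr; apply: ler_sum => i _; rewrite mulr_sumr; apply: ler_sum => j _.
    rewrite [leRHS]mulrCA; apply: (@le_trans _ _ (`|G i j| * (c i - c j) ^+ 2)).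
      by apply: ler_wpM2r; rewrite ?sqr_ge0 ?ler_norm.
    apply: ler_wpM2l => //; rewrite -exprMn.
    have := c01 i; have := c01 j; have := c2 i; have := c2 j; have := txi i; have := txi j.
    rewrite mulrDr; move: (c i) (c j) (t * _) (t * _) => a b y z /andP[z0 z1] /andP[y0 y1] ha hb.
    move=> /andP[? ?] /andP[? ?].
    have : 1 - y <= a by nra.
    have : 1 - z <= b by nra.
    move=> *; have : `|a - b| <= y + z by rewrite ler_norml; apply/andP; split; lra.
    rewrite -[X in X <= _ -> _]ger0_norm ?normr_ge0 // => h.
    rewrite -[leLHS]real_normK ?num_real // lerXn2r ?nnegrE //; last by rewrite normr_id in h.
    lra.
  rewrite -(ler_pM2l t0); rewrite dE in objE; have objle2 := objle.
  rewrite -(ler_pM2l (ltr0n R 2)) objE in objle2; rewrite -/(G _ _) in objle2.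
  change (\sum_i \sum_j M i j * (\sum_k v i k * v j k)) with (\sum_i \sum_j G i j) in objle2.
  have tt2 : t * (t * K) = t ^+ 2 * K by ring.
  rewrite mulrDr tt2; have : 0 <= t ^+ 2 * K by rewrite mulr_ge0 ?sqr_ge0.
  lra.
split=> [i||//].
  (* The diagonal of [M] vanishes, so the indicator of [i] turns the quadratic inequality into
     [0 <= d i]. *)
  have := main (fun j => (j == i)%:R); rewrite (bigD1 i) //= [X in _ + X]big1 => [|j /negPf ->].
    rewrite addr0 (bigD1 i) //= M0 !mul0r add0r big1 => [|j /negPf ->]; last by rewrite mulr0.
    rewrite (bigD1 i) //= eqxx expr1n mulr1 big1 ?addr0 // => j /negPf ->.
    by rewrite expr0n /= mulr0.
  by rewrite big1 // => l _; rewrite mulr0 mul0r.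
exact: MB.
Qed.

(** * Rigid certificates *)

(** Cholesky factorization: split off the first coordinate and apply the induction hypothesis to its
    Schur complement. *)
Lemma psd_gram {R : rcfType} {n : nat} (X : 'I_n -> 'I_n -> R) :
  (forall i j, X i j = X j i) ->
  (forall x : 'I_n -> R, 0 <= \sum_i \sum_j X i j * x i * x j) ->
  exists v : 'I_n -> 'I_n -> R, forall i j, \sum_k v i k * v j k = X i j.
Proof.
elim: n X => [|n IH] X Xsym Xpsd; first by exists (fun _ _ => 0) => -[].
pose ext (t : R) (y : 'I_n -> R) (i : 'I_n.+1) := if unlift ord0 i is Some j then y j else t.
have ext0 t y : ext t y ord0 = t by rewrite /ext unlift_none.
have extS t y j : ext t y (lift ord0 j) = y j by rewrite /ext liftK.
pose a := X ord0 ord0; pose b i := X ord0 (lift ord0 i).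
have quad t y : \sum_i \sum_j X i j * ext t y i * ext t y j =
    a * t ^+ 2 + 2 * t * (\sum_i b i * y i) +
    \sum_i \sum_j X (lift ord0 i) (lift ord0 j) * y i * y j.
  rewrite big_ord_recl big_ord_recl !ext0.
  under [X in _ + X + _ = _]eq_bigr do rewrite extS.
  under [X in _ + X = _]eq_bigr => i _.
    rewrite big_ord_recl ext0 extS (Xsym _ ord0); under eq_bigr do rewrite extS.
    over.
  rewrite big_split /= !addrA; congr (_ + _); rewrite -addrA -[X in X + _]mulrA -expr2; congr (_ + _).
  rewrite mulr_sumr -big_split; apply: eq_bigr => i _ /=; rewrite /b; ring.
have a0 : 0 <= a.
  have := Xpsd (ext 1 (fun _ => 0)); rewrite quad big1 => [|i _]; last by rewrite mulr0.
  rewrite big1 => [|i _]; first by rewrite mulr0 !addr0 expr1n mulr1.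
  by rewrite big1 // => j _; rewrite mulr0.
have b0 j : a = 0 -> b j = 0.
  move=> aE; apply/eqP; apply: contraT => bj.
  (* With a zero pivot the form is affine in the first coordinate; this value makes it equal to
     -1. *)
  have := Xpsd (ext (- (X (lift ord0 j) (lift ord0 j) + 1) / (2 * b j)) (fun i => (i == j)%:R)).
  rewrite quad aE mul0r add0r (bigD1 j) //= eqxx mulr1 big1 => [|i /negPf ->]; last by rewrite mulr0.
  rewrite (bigD1 j) //= [X in _ + (_ + X)]big1 => [|i /negPf ->]; last first.
    by rewrite big1 // => k _; rewrite mulr0 mul0r.
  rewrite (bigD1 j) //= [X in _ + ((_ + X) + _)]big1 => [|i /negPf ->]; last by rewrite mulr0.
  rewrite eqxx !mulr1 !addr0.
  have -> : 2 * (- (X (lift ord0 j) (lift ord0 j) + 1) / (2 * b j)) * b j =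
    - (X (lift ord0 j) (lift ord0 j) + 1) by field; rewrite bj.
  lra.
(* For [a = 0] nothing is subtracted, in accordance with [b0]. *)
pose Y i j := X (lift ord0 i) (lift ord0 j) - b i * b j / a.
have [|y|v vY] := IH Y.
- by move=> i j; rewrite /Y Xsym (mulrC (b i)).
- pose s := \sum_i b i * y i.
  have -> : \sum_i \sum_j Y i j * y i * y j =
      \sum_i \sum_j X (lift ord0 i) (lift ord0 j) * y i * y j - s ^+ 2 / a.
    rewrite /s expr2 !mulr_suml -sumrN -big_split.
    apply: eq_bigr => i _ /=; rewrite mulr_sumr mulr_suml -sumrN -big_split.
    by apply: eq_bigr => j _ /=; rewrite /Y; ring.
  (* The first coordinate [- s / a] minimizes the form when [a] is positive. *)
  have := Xpsd (ext (- s / a) y); rewrite quad -/s.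
  have [->|an] := eqVneq a 0; first by rewrite invr0 !(mulr0, mul0r, add0r, subr0).
  rewrite [X in 0 <= X -> _](_ : _ = \sum_i \sum_j X (lift ord0 i) (lift ord0 j) * y i * y j
    - s ^+ 2 / a) //; by field.
pose u (i k : 'I_n.+1) : R := if unlift ord0 i is Some i' then
    (if unlift ord0 k is Some k' then v i' k' else b i' / Num.sqrt a)
  else (if unlift ord0 k is Some k' then 0 else Num.sqrt a).
have sa : Num.sqrt a * Num.sqrt a = a by rewrite -expr2 sqr_sqrtr.
have bsa i : Num.sqrt a * (b i / Num.sqrt a) = b i.
  have [aE|an] := eqVneq a 0; first by rewrite b0 // mul0r mulr0.
  by rewrite mulrC divfK // sqrtr_eq0 -ltNge lt_def an.
have u00 : u ord0 ord0 = Num.sqrt a by rewrite /u !unlift_none.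
have u0S k : u ord0 (lift ord0 k) = 0 by rewrite /u unlift_none liftK.
have uS0 i : u (lift ord0 i) ord0 = b i / Num.sqrt a by rewrite /u unlift_none liftK.
have uSS i k : u (lift ord0 i) (lift ord0 k) = v i k by rewrite /u !liftK.
exists u => i j; rewrite big_ord_recl.
case: (unliftP ord0 i) => [i'|] ->; case: (unliftP ord0 j) => [j'|] ->.
- under eq_bigr do rewrite !uSS; rewrite vY !uS0 /Y mulrACA -invfM sa; ring.
- by rewrite big1 => [|k _]; rewrite ?u0S ?mulr0 // u00 uS0 addr0 mulrC bsa Xsym.
- by rewrite big1 => [|k _]; rewrite ?u0S ?mul0r // u00 uS0 addr0 bsa.
- by rewrite big1 => [|k _]; rewrite ?u0S ?mul0r // u00 addr0 sa.
Qed.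

(* For [S = setT] the matrix [(W - J) / (k - 1)] is the Gram matrix of a rigid vector k-coloring;
   in this form the parameter [k] is visibly subadditive in [S]. *)
Definition rigid_certificate {R : numDomainType} {n : nat} (h : rel 'I_n) (S : {set 'I_n}) (k : R) :
    Prop :=
  exists W : 'I_n -> 'I_n -> R,
  [/\ forall i j, W i j = W j i,
      forall i, W i i = if i \in S then k else 0,
      forall i j, i != j -> 0 <= W i j,
      forall i j, h i j -> W i j = 0 &
      forall x : 'I_n -> R, (\sum_(i in S) x i) ^+ 2 <= \sum_i \sum_j W i j * x i * x j].

Lemma rigid_certificate_le {R : realFieldType} {n : nat} (h : rel 'I_n) (S : {set 'I_n}) (k l : R) :
  0 < k -> k <= l -> rigid_certificate h S k -> rigid_certificate h S l.
Proof.
move=> k0 kl [W [Wsym Wd W0 Wh WJ]]; have kl1 : 1 <= l / k by rewrite ler_pdivlMr ?mul1r.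
have k1 : 0 <= l / k by apply: le_trans kl1.
exists (fun i j => l / k * W i j); split.
- by move=> i j; rewrite Wsym.
- by move=> i; rewrite Wd; case: ifP; rewrite ?mulr0 // divfK // gt_eqF.
- by move=> i j ij; rewrite mulr_ge0 ?W0.
- by move=> i j hij; rewrite Wh ?mulr0.
- move=> x; have -> : \sum_i \sum_j l / k * W i j * x i * x j = l / k * \sum_i \sum_j W i j * x i * x j.
    by rewrite mulr_sumr; apply: eq_bigr => i _; rewrite mulr_sumr; apply: eq_bigr => j _; rewrite !mulrA.
  apply: le_trans (WJ x) _; rewrite -[leLHS]mul1r; apply: ler_wpM2r => //.
  by apply: le_trans (WJ x); exact: sqr_ge0.
Qed.

(** Scaling both matrices to the diagonal [k + l] works by the Cauchy-Schwarz inequality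
    [(a + b)^2 <= (k + l) (a^2 / k + b^2 / l)]. *)
Lemma rigid_certificateU {R : realFieldType} {n : nat} (h : rel 'I_n) (S T : {set 'I_n}) (k l : R) :
  0 < k -> 0 < l -> [disjoint S & T] ->
  rigid_certificate h S k -> rigid_certificate h T l ->
  rigid_certificate h (S :|: T)%SET (k + l).
Proof.
move=> k0 l0 dST [W [Wsym Wd W0 Wh WJ]] [V [Vsym Vd V0 Vh VJ]].
have kn : k != 0 by rewrite gt_eqF.
have ln : l != 0 by rewrite gt_eqF.
have kl0 : 0 < k + l by rewrite addr_gt0.
exists (fun i j => (k + l) / k * W i j + (k + l) / l * V i j); split.
- by move=> i j; rewrite Wsym Vsym.
- move=> i; rewrite Wd Vd finset.in_setU; case: ifPn => iS.
    by rewrite (disjointFr dST iS) /= mulr0 addr0 divfK.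
  by rewrite mulr0 add0r /=; case: ifP; rewrite ?mulr0 ?divfK.
- by move=> i j ij; rewrite addr_ge0 ?mulr_ge0 ?W0 ?V0 ?invr_ge0 ?ltW.
- by move=> i j hij; rewrite Wh ?Vh // !mulr0 addr0.
- move=> x; have -> : \sum_i \sum_j ((k + l) / k * W i j + (k + l) / l * V i j) * x i * x j =
    (k + l) / k * (\sum_i \sum_j W i j * x i * x j) + (k + l) / l * (\sum_i \sum_j V i j * x i * x j).
    rewrite !mulr_sumr -big_split; apply: eq_bigr => i _; rewrite !mulr_sumr -big_split /=.
    by apply: eq_bigr => j _; rewrite !mulrDl !mulrA.
  have kk : 0 <= (k + l) / k by rewrite divr_ge0 ?ltW.
  have ll : 0 <= (k + l) / l by rewrite divr_ge0 ?ltW.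
  apply: le_trans (lerD (ler_wpM2l kk (WJ x)) (ler_wpM2l ll (VJ x))).
  rewrite (_ : \sum_(i in S :|: T) x i = \sum_(i in S) x i + \sum_(i in T) x i); last first.
    by rewrite -bigU //=; apply: eq_bigl => i; rewrite !inE.
  set a := \sum_(i in S) _; set b := \sum_(i in T) _.
  rewrite -subr_ge0 (_ : _ - _ = (l * a - k * b) ^+ 2 / (k * l)); last by field; rewrite kn ln.
  by rewrite divr_ge0 ?sqr_ge0 ?mulr_ge0 ?ltW.
Qed.

Lemma rigid_certificate_independent {R : realDomainType} {n : nat} (h : rel 'I_n) (S : {set 'I_n}) :
  (forall i j, i \in S -> j \in S -> ~~ h i j) -> rigid_certificate h S (1 : R).
Proof.
move=> hS; exists (fun i j => (i \in S)%:R * (j \in S)%:R); split.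
- by move=> i j; rewrite mulrC.
- by move=> i; case: (i \in S); rewrite ?mulr1 ?mulr0.
- by move=> i j _; rewrite mulr_ge0.
- move=> i j; apply: contraTeq; rewrite mulf_eq0 !pnatr_eq0 !eqb0 negb_or !negbK.
  by case/andP; exact: hS.
- move=> x; rewrite expr2 big_mkcond mulr_suml; apply: ler_sum => i _.
  rewrite mulr_sumr; apply: ler_sum => j _.
  by case: (i \in S); case: (j \in S); rewrite ?mul0r ?mulr0 ?mul0r ?mul1r ?mulr0 ?mul0r.
Qed.

(** A color class has the all-ones block as certificate, with parameter 1, and the [D + 1] classes
    add up. *)
Lemma rigid_certificate_coloring {R : realFieldType} {n : nat} (h : rel 'I_n) (D : nat)
    (S : {set 'I_n}) (c : 'I_n -> nat) :
  (forall i, i \in S -> (c i <= D)%N) ->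
  (forall i j, i \in S -> j \in S -> h i j -> c i != c j) ->
  rigid_certificate h S (D.+1%:R : R).
Proof.
elim: D S => [|D IH] S cD hc.
  apply: rigid_certificate_independent => i j iS jS; apply: contraTN isT => hij.
  have := hc _ _ iS jS hij; move: (cD _ iS) (cD _ jS); rewrite !leqn0 => /eqP -> /eqP ->.
  by rewrite eqxx.
pose T := [set i in S | (c i <= D)%N]%SET.
have -> : S = (T :|: S :\: T)%SET.
  by apply/setP => i; rewrite !inE; case: (i \in S) => //=; case: (c i <= D)%N.
rewrite -[D.+2]addn1 natrD; apply: rigid_certificateU; rewrite ?ltr0n //.
- rewrite finset.disjoints_subset; apply/fintype.subsetP => i iT.
  by rewrite finset.in_setC finset.in_setD iT.
- apply: IH => [i|i j]; rewrite !inE => /andP[// iS _] /andP[jS _]; exact: hc.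
- apply: rigid_certificate_independent => i j; rewrite !inE => /andP[+ iS] /andP[+ jS].
  rewrite iS jS /= -!ltnNge => ci cj; apply/negP => /(hc _ _ iS jS).
  have top l : l \in S -> (D < c l)%N -> c l = D.+1.
    by move=> lS cl; apply/eqP; rewrite eqn_leq cD.
  by rewrite (top i iS ci) (top j jS cj) eqxx.
Qed.

(** Remove a vertex of degree at most [D] and color the rest: its neighbors leave one of the [D + 1]
    colors free. *)
Lemma degenerate_coloring {n : nat} (h : rel 'I_n) (D : nat) (S : {set 'I_n}) :
  irreflexive h -> symmetric h ->
  (forall T : {set 'I_n}, T \subset S -> T != finset.set0 ->
     exists2 i, i \in T & (#|[set j in T | h i j]%SET| <= D)%N) ->
  exists c : 'I_n -> nat, (forall i, (c i <= D)%N) /\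
    forall i j, i \in S -> j \in S -> h i j -> c i != c j.
Proof.
move=> hirr hsym; have [m mE] := ubnP #|S|; elim: m S mE => // m IH S Sm hS.
have [->|S0] := eqVneq S finset.set0; first by exists (fun _ => 0%N); split=> // i j; rewrite inE.
have [i0 i0S degi0] := hS S (subxx _) S0.
have [||c [cD hc]] := IH (S :\ i0).
- by move: Sm; rewrite (cardsD1 i0) i0S add1n ltnS.
- by move=> T TS; apply: hS; exact: fintype.subset_trans TS (finset.subD1set _ _).
pose forb := [set (inord (c j) : 'I_D.+1) | j in [set j in S | h i0 j]]%SET.
have [k kforb] : exists k : 'I_D.+1, k \notin forb.
  apply/existsP; rewrite -negb_forall; apply/negP => /forallP forbT.
  have : (#|forb| <= D)%N by apply: leq_trans (leq_imset_card _ _) degi0.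
  rewrite (_ : forb = [set: 'I_D.+1]%SET) ?cardsT ?card_ord ?ltnn //.
  by apply/setP => k; rewrite inE forbT.
have kc j : j \in S -> h i0 j -> c j != k.
  move=> jS hj; apply: contraNneq kforb => ck; apply/imsetP; exists j; first by rewrite inE jS.
  by rewrite ck inord_val.
exists (fun i => if i == i0 then k : nat else c i); split=> [i|i j iS jS hij].
  by case: ifP => // _; rewrite -ltnS.
case: (eqVneq i i0) => [ii0|ni]; case: (eqVneq j i0) => [ji0|nj].
- by rewrite ii0 ji0 hirr in hij.
- by rewrite eq_sym kc // -ii0.
- by rewrite kc // hsym -ji0.
- by apply: hc; rewrite // !inE ?ni ?nj.
Qed.

(** The center [q] is a parameter because the complement is centered at [1 - q], which only changes
    the sign of the matrix. *)
Definition centered {R : pzRingType} {n : nat} (q : R) (h : rel 'I_n) (i j : 'I_n) : R :=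
  if i == j then 0 else (h i j)%:R - q.

(** On [S] the witness is [J - M / (1 - q) + K / (1 - q) I] with M the centered matrix. Its entries
    are 0 on edges and [1 / (1 - q)] on non-edges, and subtracting J leaves exactly the spectral
    bound. *)
Lemma rigid_certificate_spectral {R : realFieldType} {n : nat} (h : rel 'I_n) (S : {set 'I_n})
    (q K : R) :
  irreflexive h -> symmetric h -> q < 1 ->
  (forall x : 'I_n -> R, (forall i, i \notin S -> x i = 0) ->
     \sum_i \sum_j centered q h i j * x i * x j <= K * \sum_i x i ^+ 2) ->
  rigid_certificate h S (1 + K / (1 - q)).
Proof.
move=> hirr hsym q1 hK; have q0 : 0 < 1 - q by rewrite subr_gt0.
have qn : 1 - q != 0 by rewrite gt_eqF.
pose W i j := if (i \in S) && (j \in S) then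
  (if i == j then 1 + K / (1 - q) else if h i j then 0 else (1 - q)^-1) else 0.
exists W; split.
- by move=> i j; rewrite /W andbC eq_sym hsym.
- by move=> i; rewrite /W andbb eqxx.
- by move=> i j /negPf ij; rewrite /W ij; do 2!case: ifP => //; rewrite invr_ge0 ltW.
- move=> i j hij; rewrite /W hij; case: eqP => [ij|]; last by case: ifP.
  by rewrite ij hirr in hij.
- move=> x; pose y i := if i \in S then x i else 0.
  have -> : \sum_(i in S) x i = \sum_i y i by rewrite big_mkcond.
  have WE i j : W i j * x i * x j = y i * y j - (1 - q)^-1 * (centered q h i j * y i * y j) +
      (if i == j then K / (1 - q) * y i ^+ 2 else 0).
    rewrite /W /y /centered; case: (eqVneq i j) => [<-|ij].
      by rewrite andbb; case: (i \in S); [ring|rewrite !(mul0r, mulr0, expr0n, addr0, subr0)].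
    by case: (i \in S); case: (j \in S); case: (h i j) => /=;
      rewrite ?(mul0r, mulr0, expr0n, addr0, subr0) //=; field.
  under [leRHS]eq_bigr do under eq_bigr do rewrite WE.
  have -> : \sum_i \sum_j (y i * y j - (1 - q)^-1 * (centered q h i j * y i * y j) +
      (if i == j then K / (1 - q) * y i ^+ 2 else 0)) =
    (\sum_i y i) ^+ 2 - (1 - q)^-1 * (\sum_i \sum_j centered q h i j * y i * y j)
      + K / (1 - q) * \sum_i y i ^+ 2.
    rewrite expr2 mulr_suml !mulr_sumr -sumrN -!big_split; apply: eq_bigr => i _ /=.
    rewrite mulr_sumr mulr_sumr -sumrN !big_split /=; congr (_ + _ + _).
    by rewrite -big_mkcond /= (big_pred1 i) // => j; rewrite eq_sym.
  have hy : forall i, i \notin S -> y i = 0 by move=> i /negPf iS; rewrite /y iS.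
  have c0 : 0 <= (1 - q)^-1 by rewrite invr_ge0 ltW.
  have := ler_wpM2l c0 (hK y hy); move: (1 - q)^-1 => c; lra.
Qed.

(** * Vector colorings from and against cut bounds *)

Lemma sum_setT {V : nmodType} {I : finType} (F : I -> V) :
  \sum_(i in [set: I]%SET) F i = \sum_i F i.
Proof. by apply: eq_bigl => i; rewrite inE. Qed.

Lemma dotvE {R : realType} {n : nat} (u v : 'rV[R]_n) : dotv u v = \sum_k u 0 k * v 0 k.
Proof. by rewrite /dotv mxE; apply: eq_bigr => k _; rewrite mxE. Qed.

Lemma adj_irr {n : nat} (E : graph n) : irreflexive (adj E).
Proof. by move=> i; rewrite /adj eqxx. Qed.

Lemma adj_sym {n : nat} (E : graph n) : symmetric (adj E).
Proof. by move=> i j; rewrite /adj eq_sym finset.setUC. Qed.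

Lemma adj_compl {n : nat} (E : graph n) (i j : 'I_n) :
  adj (compl_graph E) i j = (i != j) && ~~ adj E i j.
Proof.
rewrite /adj /compl_graph finset.in_setD /pairs !inE cards2.
by case: (i != j) => //=; rewrite andbT.
Qed.

Lemma centered_compl {R : comPzRingType} {n : nat} (q : R) (E : graph n) (i j : 'I_n) :
  centered (1 - q) (adj (compl_graph E)) i j = - centered q (adj E) i j.
Proof.
rewrite /centered adj_compl; case: eqP => _; first by rewrite oppr0.
by case: (adj E i j) => /=; ring.
Qed.

Lemma rigid_coloring_of_certificate {R : realType} {n : nat} (E : graph n) (k : R) :
  1 < k -> rigid_certificate (adj E) [set: 'I_n]%SET k ->
  exists v : 'I_n -> 'rV[R]_n, rigid_vector_coloring E k v.
Proof.
move=> k1 [W [Wsym Wd W0 Wh WJ]]; have k0 : 0 < k - 1 by rewrite subr_gt0.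
have kn : k - 1 != 0 by rewrite gt_eqF.
have [i j|x|v vX] := @psd_gram R n (fun i j => (W i j - 1) / (k - 1)).
- by rewrite Wsym.
- rewrite (_ : \sum_i _ = (k - 1)^-1 * (\sum_i \sum_j W i j * x i * x j - (\sum_i x i) ^+ 2)).
    apply: mulr_ge0; first by rewrite invr_ge0 ltW.
    by rewrite subr_ge0; apply: le_trans (WJ x); rewrite sum_setT.
  rewrite expr2 mulr_suml -sumrN -big_split mulr_sumr; apply: eq_bigr => i _ /=.
  rewrite mulr_sumr -sumrN -big_split mulr_sumr; apply: eq_bigr => j _ /=; ring.
exists (fun i => \row_k v i k).
have dotE i j : dotv (\row_k v i k) (\row_k v j k) = (W i j - 1) / (k - 1).
  by rewrite dotvE -vX; apply: eq_bigr => l _; rewrite !mxE.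
split; first by move=> i; rewrite dotE Wd inE divff.
split=> [i j ij|i j ij _].
  by rewrite dotE Wh // sub0r mulN1r.
by rewrite dotE -[- (k - 1)^-1]mulN1r ler_pM2r ?invr_gt0 // lerBrDr addNr W0.
Qed.

Lemma theta_bar_2_le {R : realType} {n : nat} (E : graph n) (k : R) :
  1 < k -> rigid_certificate (adj E) [set: 'I_n]%SET k -> theta_bar_2 R E <= k.
Proof.
move=> k1 /(rigid_coloring_of_certificate E k k1) vE; apply: ge_inf; last by [].
by exists 1 => l [/ltW].
Qed.

(** One color per vertex. This makes the sets of admissible [k] nonempty, so that their infima are
    genuine. *)
Lemma rigid_coloring_exists {R : realType} {n : nat} (E : graph n) : (1 < n)%N ->
  exists v : 'I_n -> 'rV[R]_n, rigid_vector_coloring E n%:R v.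
Proof.
case: n E => // n E n1; apply: rigid_coloring_of_certificate; first by rewrite ltr1n.
apply: (@rigid_certificate_coloring _ _ _ _ _ (fun i : 'I_n.+1 => i : nat)).
  by move=> i _; rewrite -ltnS.
by move=> i j _ _; apply: contraTneq => /val_inj ->; rewrite adj_irr.
Qed.

Lemma theta_bar_half_ge {R : realType} {n : nat} (E : graph n) (c : R) : (1 < n)%N ->
  (forall k v, 1 < k -> vector_coloring E k v -> c <= k) -> c <= theta_bar_half R E.
Proof.
move=> n1 ck; apply: lb_le_inf; last by move=> k [k1 [v vE]]; exact: ck vE.
have [v [v1 [vE _]]] := @rigid_coloring_exists R n E n1.
exists n%:R; split; first by rewrite ltr1n.
by exists v; split=> // i j ij; rewrite vE.
Qed.

Lemma theta_bar_half_le {R : realType} {n : nat} (E : graph n) : (1 < n)%N ->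
  theta_bar_half R E <= theta_bar R E.
Proof.
move=> n1; apply: lb_le_inf.
  have [v [v1 [vE _]]] := @rigid_coloring_exists R n E n1.
  by exists n%:R; split; [rewrite ltr1n|exists v].
move=> k [k1 [v [v1 vE]]]; apply: ge_inf; first by exists 1 => l [/ltW].
by split=> //; exists v; split=> // i j ij; rewrite vE.
Qed.

Lemma theta_bar_le {R : realType} {n : nat} (E : graph n) : (1 < n)%N ->
  theta_bar R E <= theta_bar_2 R E.
Proof.
move=> n1; apply: lb_le_inf.
  have [v vE] := @rigid_coloring_exists R n E n1.
  by exists n%:R; split; [rewrite ltr1n|exists v].
move=> k [k1 [v [v1 [vE _]]]]; apply: ge_inf; first by exists 1 => l [/ltW].
by split=> //; exists v.
Qed.

(** A bound on the norm from infinity to 1 of the block on [S], which is the cut norm up to a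
    constant factor. One side suffices, since negating [x] changes the sign of the sum. *)
Definition cut_bound {R : numDomainType} {n : nat} (q : R) (h : rel 'I_n) (S : {set 'I_n}) (a : R) :
    Prop :=
  forall x y : 'I_n -> bool,
  \sum_(i in S) \sum_(j in S) centered q h i j * rsign (x i) * rsign (y j) <= a.

Lemma rsignN {R : pzRingType} b : rsign (~~ b) = - rsign b :> R.
Proof. by case: b; rewrite /= ?opprK. Qed.

Lemma cut_bound_compl {R : numDomainType} {n : nat} (q : R) (E : graph n) (S : {set 'I_n}) (a : R) :
  cut_bound q (adj E) S a -> cut_bound (1 - q) (adj (compl_graph E)) S a.
Proof.
move=> Ea x y; apply: le_trans (Ea (fun i => ~~ x i) y).
apply: ler_sum => i _; apply: ler_sum => j _.
by rewrite centered_compl rsignN mulrN mulNr.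
Qed.

(** Keep the vertices whose dual weight is at most [K]. By Grothendieck and duality the weights sum
    to at most [98 * a], so Markov's inequality limits the loss. *)
Lemma exists_spectral_part {R : realType} {n : nat} (q a K : R) (h : rel 'I_n) (S : {set 'I_n}) :
  symmetric h -> 0 < K -> cut_bound q h S a ->
  exists V : {set 'I_n}, [/\ V \subset S, #|S :\: V|%:R * K <= 98 * a &
    forall x : 'I_n -> R, (forall i, i \notin V -> x i = 0) ->
     \sum_i \sum_j centered q h i j * x i * x j <= K * \sum_i x i ^+ 2].
Proof.
move=> hsym K0 Sa; pose M i j := if (i \in S) && (j \in S) then centered q h i j else 0.
have csym i j : centered q h i j = centered q h j i by rewrite /centered eq_sym hsym.
have Ma (x y : 'I_n -> bool) : \sum_i \sum_j M i j * rsign (x i) * rsign (y j) <= a.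
  apply: le_trans (Sa x y); rewrite [leRHS]big_mkcond; apply: ler_sum => i _ /=.
  rewrite /M; case: ifP => iS /=.
    rewrite [leRHS]big_mkcond; apply: ler_sum => j _; case: ifP => //= _; by rewrite !mul0r.
  by apply: sumr_le0 => j _; rewrite !mul0r.
have [|||d [d0 dsum dM]] := @sdp_duality R n M (98 * a).
- by move=> i j; rewrite /M andbC csym.
- by move=> i; rewrite /M /centered eqxx if_same.
- by move=> u u1; apply: (grothendieck _ _ Ma) => i; rewrite u1.
exists [set i in S | d i <= K]%SET; split.
- by apply/fintype.subsetP => i; rewrite inE => /andP[].
- apply: le_trans dsum; rewrite mulr_natl -sumr_const.
  apply: (@le_trans _ _ (\sum_(i in S :\: [set i in S | d i <= K]%SET) d i)).
    by apply: ler_sum => i; rewrite !inE => /andP[+ iS]; rewrite iS /= -ltNge => /ltW.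
  by rewrite [leLHS]big_mkcond; apply: ler_sum => i _; case: ifP.
- move=> x xV; have xS i : i \notin S -> x i = 0.
    by move=> iS; apply: xV; rewrite inE (negPf iS).
  rewrite (_ : \sum_i \sum_j _ = \sum_i \sum_j M i j * x i * x j).
    apply: le_trans (dM x) _; rewrite mulr_sumr; apply: ler_sum => i _.
    have [iV|/xV ->] := boolP (i \in [set i in S | d i <= K]%SET); last first.
      by rewrite expr0n /= !mulr0.
    by apply: ler_wpM2r; rewrite ?sqr_ge0 //; move: iV; rewrite inE => /andP[].
  apply: eq_bigr => i _; apply: eq_bigr => j _; rewrite /M.
  have [iS|/xS ->] := boolP (i \in S); last by rewrite !mulr0 !mul0r.
  by have [jS|/xS ->] := boolP (j \in S); last by rewrite !mulr0.
Qed.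

(* At level [l] the spectral part is certified with parameter [1 + O(t / 2 ^ l)], and a sixteenth
   of the vertices is passed on to level [l + 1]. *)
Lemma rigid_certificate_peeling {R : realType} {n : nat} (q t k0 : R) (N : nat) (h : rel 'I_n) :
  irreflexive h -> symmetric h -> q < 1 -> 0 < t -> 0 < k0 ->
  (forall l (S : {set 'I_n}), (l < N)%N -> #|S|%:R <= n%:R / 16 ^+ l :> R ->
     cut_bound q h S (n%:R / 16 ^+ l * (t / 2 ^+ l))) ->
  (forall S : {set 'I_n}, #|S|%:R <= n%:R / 16 ^+ N :> R -> rigid_certificate h S k0) ->
  rigid_certificate h [set: 'I_n]%SET (k0 + N%:R + 32 * (98 * (t / (1 - q)))).
Proof.
move=> hirr hsym q1 t0 k00 hcut hres; have q0 : 0 < 1 - q by rewrite subr_gt0.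
pose c : R := 98 * (t / (1 - q)).
have c0 : 0 < c by apply: mulr_gt0; [rewrite ltr0n|exact: divr_gt0].
have cl0 l : 0 < c / 2 ^+ l by apply: divr_gt0 => //; rewrite exprn_gt0.
suff step m l (S : {set 'I_n}) : (l + m = N)%N -> #|S|%:R <= n%:R / 16 ^+ l :> R ->
    rigid_certificate h S (k0 + m%:R + 32 * (c / 2 ^+ l)).
  have := step N 0%N [set: 'I_n]%SET (add0n _).
  by rewrite !expr0 !divr1 cardsT card_ord; exact.
elim: m l S => [|m IH] l S lN Sl.
  have hS : rigid_certificate h S k0 by apply: hres; rewrite -lN addn0.
  apply: (rigid_certificate_le _ _ k0) => //; have := cl0 l; rewrite addr0; lra.
pose tl := t / 2 ^+ l; have tl0 : 0 < tl by rewrite divr_gt0 ?exprn_gt0.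
(* With this [K], the factor 98 cancels in the count of discarded vertices and leaves
   [n / 16 ^ l.+1]. *)
have K0 : 0 < 16 * (98 * tl) by lra.
have Scut : cut_bound q h S (n%:R / 16 ^+ l * tl).
  by apply: hcut => //; rewrite -lN addnS ltnS leq_addr.
have [V [VS Vcard Vx]] := exists_spectral_part _ _ _ _ _ hsym K0 Scut.
have certV := rigid_certificate_spectral h V q _ hirr hsym q1 Vx.
have certR : rigid_certificate h (S :\: V)%SET (k0 + m%:R + 32 * (c / 2 ^+ l.+1)).
  apply: IH; first by rewrite addSn -addnS.
  rewrite exprSr invfM mulrA ler_pdivlMr //.
  have tl98 : 0 < 98 * tl by lra.
  rewrite -(ler_pM2r tl98); apply: le_trans (le_trans _ Vcard) _; first by rewrite -mulrA.
  by rewrite mulrCA.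
have -> : S = (V :|: S :\: V)%SET.
  apply/setP => i; rewrite !inE; case: (boolP (i \in V)) => //= iV.
  by rewrite (fintype.subsetP VS).
have q1n : 1 - q != 0 by rewrite gt_eqF.
(* The constant 32 is 16 times the sum of the geometric series of ratio 1/2; the summand 1 of each
   level is counted by [m]. *)
have -> : k0 + m.+1%:R + 32 * (c / 2 ^+ l) =
   (1 + 16 * (98 * tl) / (1 - q)) + (k0 + m%:R + 32 * (c / 2 ^+ l.+1)).
  rewrite -natr1 exprSr invfM /tl /c; move: (2 ^+ l)^-1 => b; field; exact: q1n.
apply: rigid_certificateU => //.
- by apply: addr_gt0 => //; exact: divr_gt0.
- have := cl0 l.+1; have : 0 <= m%:R :> R by rewrite ler0n.
  lra.
- rewrite finset.disjoints_subset; apply/fintype.subsetP => i iV.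
  by rewrite finset.in_setC finset.in_setD iV.
Qed.

(** The inner products are summed over the edges in two ways. The coloring bounds the sum above by
    minus the number of ordered edges over [k - 1]; splitting the adjacency matrix into its mean and
    M bounds it below, because the sum over all pairs is [|sum v|^2 - n] and Grothendieck controls
    M. Constant signs in the cut bound give the number of edges. *)
Lemma vector_coloring_bound {R : realType} {n : nat} (q t k : R) (E : graph n)
    (v : 'I_n -> 'rV[R]_n) :
  (0 < n)%N -> 0 <= q -> 1 < k -> vector_coloring E k v ->
  cut_bound q (adj E) [set: 'I_n]%SET (n%:R * t) ->
  q * (n%:R - 1) - t <= (k - 1) * (q + 98 * t).
Proof.
move=> n0 q0 k1 [v1 vE] Et; have k0 : 0 < k - 1 by rewrite subr_gt0.
have n0' : 0 < n%:R :> R by rewrite ltr0n.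
pose h i j : R := (adj E i j)%:R; pose D i j := dotv (v i) (v j).
pose N (i j : 'I_n) : R := (i != j)%:R.
have hN i j : h i j = q * N i j + centered q (adj E) i j.
  by rewrite /h /N /centered; case: eqP => [->|_] /=; rewrite ?adj_irr ?mulr0 ?add0r ?mulr1 ?subrKC.
have edges : \sum_i \sum_j h i j * D i j <= - ((k - 1)^-1 * \sum_i \sum_j h i j).
  rewrite mulr_sumr -sumrN; apply: ler_sum => i _; rewrite mulr_sumr -sumrN; apply: ler_sum => j _.
  rewrite /h /D; case: (boolP (adj E i j)) => [/vE|_]; last by rewrite mul0r mulr0 oppr0.
  by rewrite mul1r mulr1.
have cut2 (x y : 'I_n -> bool) :
    \sum_i \sum_j - centered q (adj E) i j * rsign (x i) * rsign (y j) <= n%:R * t.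
  have := Et (fun i => ~~ x i) y; rewrite sum_setT; apply: le_trans; apply: ler_sum => i _.
  by rewrite sum_setT; apply: ler_sum => j _; rewrite rsignN mulrN mulNr.
have groth : \sum_i \sum_j - centered q (adj E) i j * D i j <= 98 * (n%:R * t).
  have vi i : \sum_k v i 0 k ^+ 2 <= 1.
    by rewrite -(v1 i) dotvE le_eqVlt; apply/orP; left; apply/eqP; apply: eq_bigr => l _.
  have := @grothendieck R n _ _ cut2 _ (fun i k => v i 0 k) (fun i k => v i 0 k) vi vi.
  by under eq_bigr do under eq_bigr do rewrite -dotvE.
have total : - n%:R <= \sum_i \sum_j N i j * D i j.
  have -> : \sum_i \sum_j N i j * D i j = \sum_k (\sum_i v i 0 k) ^+ 2 - n%:R.
    have -> : \sum_i \sum_j N i j * D i j = \sum_i (\sum_j D i j - 1).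
      apply: eq_bigr => i _; rewrite (bigD1 i) //= [in RHS](bigD1 i) //= /N eqxx mul0r add0r.
      rewrite /D v1 [1 + _]addrC addrK; apply: eq_bigr => j ji.
      by rewrite eq_sym ji mul1r.
    rewrite big_split /= sumr_const card_ord mulNrn; congr (_ - _).
    under eq_bigr do under eq_bigr do rewrite /D dotvE.
    under eq_bigr do rewrite exchange_big.
    rewrite exchange_big; apply: eq_bigr => l _ /=.
    by rewrite expr2 mulr_suml; apply: eq_bigr => i _; rewrite mulr_sumr.
  by rewrite lerDr; apply: sumr_ge0 => l _; exact: sqr_ge0.
have splitD : \sum_i \sum_j h i j * D i j = q * (\sum_i \sum_j N i j * D i j) -
    \sum_i \sum_j - centered q (adj E) i j * D i j.
  rewrite mulr_sumr -sumrN -big_split; apply: eq_bigr => i _; rewrite mulr_sumr -sumrN -big_split.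
  by apply: eq_bigr => j _ /=; rewrite hN; ring.
have hcount : q * (n%:R * (n%:R - 1)) - n%:R * t <= \sum_i \sum_j h i j.
  have -> : \sum_i \sum_j h i j = q * (\sum_i \sum_j N i j) -
      \sum_i \sum_j - centered q (adj E) i j * rsign true * rsign true.
    rewrite mulr_sumr -sumrN -big_split; apply: eq_bigr => i _; rewrite mulr_sumr -sumrN -big_split.
    by apply: eq_bigr => j _ /=; rewrite hN /rsign; ring.
  have := cut2 (fun=> true) (fun=> true).
  have -> : \sum_i \sum_j N i j = n%:R * (n%:R - 1); last by lra.
  transitivity (\sum_(i < n) (n%:R - 1 : R)); last by rewrite sumr_const card_ord mulr_natl.
  apply: eq_bigr => i _; rewrite -[n in n%:R](card_ord n) -sum1_card natr_sum (bigD1 i) //=.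
  rewrite [in RHS](bigD1 i) //= /N eqxx add0r [1 + _]addrC addrK; apply: eq_bigr => j.
  by rewrite eq_sym => ->.
have qtotal := ler_wpM2l q0 total.
have key : (k - 1)^-1 * (q * (n%:R * (n%:R - 1)) - n%:R * t) <= q * n%:R + 98 * (n%:R * t).
  have k0' : 0 <= (k - 1)^-1 by rewrite invr_ge0 ltW.
  have := ler_wpM2l k0' hcount; lra.
rewrite -(ler_pM2l n0') -subr_ge0; move: key; rewrite mulrC ler_pdivrMr // -subr_ge0.
by congr (0 <= _); ring.
Qed.

(** * Cut bounds of random graphs *)

Lemma expR_le_quadratic {R : realType} (x : R) : x <= 1 / 2 -> expR x <= 1 + x + 2 * x ^+ 2.
Proof.
move=> x2; have x1 : 0 < 1 - x by lra.
have : expR x <= (1 - x)^-1.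
  rewrite -[expR x]invrK -expRN lef_pV2 ?posrE ?expR_gt0 //; exact: expR_ge1Dx.
move/le_trans; apply; rewrite -div1r ler_pdivrMr // -subr_ge0.
rewrite (_ : _ - 1 = x ^+ 2 * (1 - 2 * x)); last by ring.
by rewrite mulr_ge0 ?sqr_ge0 //; lra.
Qed.

Lemma expR1_le4 {R : realType} : expR 1 <= 4 :> R.
Proof.
have : expR (1 / 2) <= 2 :> R.
  rewrite -[expR _]invrK -expRN -[leRHS]invrK lef_pV2 ?posrE ?invr_gt0 ?expR_gt0 //.
  have := @expR_ge1Dx R (- (1 / 2)); lra.
have -> : expR 1 = expR (1 / 2) ^+ 2 :> R by rewrite -expRM_natl; congr expR; lra.
have := @expR_gt0 R (1 / 2); nra.
Qed.

Lemma expR1_ge2 {R : realType} : 2 <= expR 1 :> R.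
Proof. have := @expR_ge1Dx R 1; lra. Qed.

(** The coefficient of the edge [e] in the bilinear form. Both orientations are collected, so that
    the form becomes a sum over independent edge indicators. *)
Definition cut_weight {R : realType} {n : nat} (x y : 'I_n -> R) (S e : {set 'I_n}) : R :=
  \sum_(ij : 'I_n * 'I_n | (ij.1 != ij.2) && ([set ij.1; ij.2]%SET == e))
    (if (ij.1 \in S) && (ij.2 \in S) then x ij.1 * y ij.2 else 0).

Lemma sum_cut_weight {R : realType} {n : nat} (x y : 'I_n -> R) (S : {set 'I_n})
    (w : {set 'I_n} -> R) :
  \sum_(e in pairs n) cut_weight x y S e * w e =
  \sum_(i in S) \sum_(j in S) (if i == j then 0 else w [set i; j]%SET * x i * y j).
Proof.
transitivity (\sum_i \sum_(j | i != j) (if (i \in S) && (j \in S) then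
    w [set i; j]%SET * x i * y j else 0)).
  rewrite sum_ordered_pairs; apply: eq_bigr => e _; rewrite /cut_weight mulr_suml.
  apply: eq_bigr => ij /andP[_ /eqP ->]; case: ifP => _; rewrite ?mul0r //.
  by rewrite mulrC mulrA.
rewrite [RHS]big_mkcond; apply: eq_bigr => i _; case: ifP => iS /=; last by rewrite big1.
rewrite big_mkcond [RHS]big_mkcond; apply: eq_bigr => j _.
by case: eqP => //= _; case: ifP.
Qed.

Lemma cut_sum_centered {R : realType} {n : nat} (p : R) (E : graph n) (x y : 'I_n -> R)
    (S : {set 'I_n}) :
  \sum_(i in S) \sum_(j in S) centered p (adj E) i j * x i * y j =
  \sum_(e in pairs n) cut_weight x y S e * ((e \in E)%:R - p).
Proof.
rewrite sum_cut_weight; apply: eq_bigr => i _; apply: eq_bigr => j _.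
by rewrite /centered /adj; case: eqP => //= _; rewrite !mul0r.
Qed.

Lemma cut_sum_adj {R : realType} {n : nat} (E : graph n) (S : {set 'I_n}) :
  \sum_(i in S) \sum_(j in S) (adj E i j)%:R =
  \sum_(e in pairs n) cut_weight (fun=> 1) (fun=> 1) S e * (e \in E)%:R :> R.
Proof.
rewrite sum_cut_weight; apply: eq_bigr => i _; apply: eq_bigr => j _.
by rewrite /adj; case: eqP => //= _; rewrite !mulr1.
Qed.

Lemma cut_weight_bound {R : realType} {n : nat} (x y : 'I_n -> R) (S : {set 'I_n}) e :
  (forall i, `|x i| <= 1) -> (forall i, `|y i| <= 1) -> e \in pairs n ->
  `|cut_weight x y S e| <= cut_weight (fun=> 1) (fun=> 1) S e /\
  (cut_weight (fun=> 1) (fun=> 1) S e = 0 :> R \/ cut_weight (fun=> 1) (fun=> 1) S e = 2 :> R).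
Proof.
move=> x1 y1; rewrite /pairs inE => /cards2P[a [b [ab ->]]].
rewrite /cut_weight (sum_edge_orientations (fun i j =>
  if (i \in S) && (j \in S) then x i * y j else 0)) //.
rewrite (sum_edge_orientations (fun i j => if (i \in S) && (j \in S) then 1 * 1 else 0)) //.
have xy i j : `|x i * y j| <= 1 by rewrite normrM mulr_ile1.
rewrite [(b \in S) && _]andbC; case: ifP => _; last by rewrite addr0 normr0; split=> //; left.
rewrite mulr1; split; last by right.
apply: le_trans (ler_normD _ _) _; exact: lerD.
Qed.

Lemma sum_cut_weight1 {R : realType} {n : nat} (S : {set 'I_n}) :
  \sum_(e in pairs n) cut_weight (fun=> 1) (fun=> 1) S e <= #|S|%:R ^+ 2 :> R.
Proof.
rewrite -[leLHS](_ : \sum_(e in pairs n) cut_weight (fun=> 1) (fun=> 1) S e * 1 = _); last first.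
  by apply: eq_bigr => e _; rewrite mulr1.
rewrite (sum_cut_weight _ _ _ (fun=> 1)).
apply: (@le_trans _ _ (\sum_(i in S) \sum_(j in S) 1)).
  by apply: ler_sum => i _; apply: ler_sum => j _; case: eqP; rewrite ?mulr1.
by rewrite !sumr_const expr2 mulr_natl.
Qed.

(** An edge inside [S] has a coefficient [u] with [|u| <= 2], so [a <= 1 / 4] keeps [a u] in the
    range of [expR_le_quadratic]. The linear terms cancel against the centering. *)
Lemma cut_mgf {R : realType} {n : nat} (p a : R) (x y : 'I_n -> R) (S : {set 'I_n}) :
  0 <= p <= 1 -> 0 <= a <= 1 / 4 -> (forall i, `|x i| <= 1) -> (forall i, `|y i| <= 1) ->
  gnp_E p (fun E => expR (a * \sum_(i in S) \sum_(j in S) centered p (adj E) i j * x i * y j))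
  <= expR (4 * a ^+ 2 * p * #|S|%:R ^+ 2).
Proof.
move=> p01 /andP[a0 a4] x1 y1; have /andP[p0 _] := p01.
pose c := cut_weight x y S; pose s := \sum_(e in pairs n) c e.
have -> : gnp_E p (fun E => expR (a * \sum_(i in S) \sum_(j in S) centered p (adj E) i j * x i * y j))
  = expR (- (a * p * s)) * gnp_E p (fun E => expR (\sum_(e in pairs n) (a * c e) * (e \in E)%:R)).
  rewrite -gnp_EZ; apply: eq_bigr => E _; rewrite -expRD cut_sum_centered; congr (_ * expR _).
  rewrite /s !mulr_sumr -sumrN -big_split; apply: eq_bigr => e _ /=; rewrite -/c; ring.
apply: le_trans (ler_wpM2l (expR_ge0 _) (gnp_mgf _ _ p01)) _.
rewrite -expRD ler_expR.
apply: (@le_trans _ _ (p * \sum_(e in pairs n) 4 * a ^+ 2 * cut_weight (fun=> 1) (fun=> 1) S e)).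
  rewrite -[a * p]mulrC /s -mulrA -mulrN -mulrDr; apply: ler_wpM2l => //.
  rewrite mulr_sumr -sumrN -big_split; apply: ler_sum => e eP /=.
  have [ce ce2] := cut_weight_bound x y S e x1 y1 eP.
  move: ce ce2; rewrite -/(c e) ler_norml; move: (c e) (cut_weight _ _ _ _) => u v /andP[u1 u2] v2.
  have v02 : 0 <= v <= 2 by case: v2 => ->; lra.
  have /expR_le_quadratic : a * u <= 1 / 2 by nra.
  have : u ^+ 2 <= 2 * v by nra.
  have : 0 <= a ^+ 2 by exact: sqr_ge0.
  rewrite exprMn; nra.
rewrite -mulr_sumr mulrCA -[leRHS]mulrA; apply: ler_wpM2l; first by rewrite mulr_ge0 ?sqr_ge0.
by apply: ler_wpM2l => //; exact: sum_cut_weight1.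
Qed.

(** Here [a] may be large, of the order of a logarithm, so the exponential is not expanded. The
    halves undo the double counting of edges. *)
Lemma edge_count_mgf {R : realType} {n : nat} (p a : R) (S : {set 'I_n}) :
  0 <= p <= 1 -> 0 <= a ->
  gnp_E p (fun E => expR (a / 2 * \sum_(i in S) \sum_(j in S) (adj E i j)%:R))
  <= expR (p * expR a * #|S|%:R ^+ 2 / 2).
Proof.
move=> p01 a0; have /andP[p0 _] := p01.
pose c := @cut_weight R n (fun=> 1) (fun=> 1) S.
have -> : gnp_E p (fun E => expR (a / 2 * \sum_(i in S) \sum_(j in S) (adj E i j)%:R)) =
  gnp_E p (fun E => expR (\sum_(e in pairs n) (a / 2 * c e) * (e \in E)%:R)).
  apply: eq_bigr => E _; congr (_ * expR _); rewrite cut_sum_adj mulr_sumr.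
  by apply: eq_bigr => e _; rewrite mulrA.
apply: le_trans (gnp_mgf _ _ p01) _; rewrite ler_expR.
have -> : p * expR a * #|S|%:R ^+ 2 / 2 = p * (expR a * (2^-1 * #|S|%:R ^+ 2)) by ring.
apply: ler_wpM2l => //.
have e0 := expR_gt0 a.
apply: (@le_trans _ _ (\sum_(e in pairs n) expR a * (2^-1 * c e))).
  apply: ler_sum => e eP.
  have one (i : 'I_n) : `|1 : R| <= 1 by rewrite normr1.
  have [_] := cut_weight_bound (fun=> 1) (fun=> 1) S e one one eP.
  rewrite -/(c e) => -[] ->; first by rewrite !mulr0 expR0 subrr.
  by rewrite divfK // mulVf // mulr1 lerBlDr lerDl.
rewrite -!mulr_sumr; apply: ler_wpM2l; first exact: ltW.
by apply: ler_wpM2l; rewrite ?invr_ge0 ?ler0n //; exact: sum_cut_weight1.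
Qed.

(** Rankin's trick: with [th = 16 ^- l] and [m = n th], the condition [#|S| <= m] is relaxed to a
    factor [th ^ #|S|] times exp (4 l m), which is at least 1 on these sets. The sum over all [S] is
    then [(1 + 4 th) ^ n <= exp (4 m)]. *)
Lemma count_level_cuts {R : realType} {n : nat} (l : nat) :
  \sum_(S : {set 'I_n} | #|S|%:R <= n%:R / 16 ^+ l :> R)
    \sum_(P : {set 'I_n} | P \subset S) \sum_(Q : {set 'I_n} | Q \subset S) 1 <=
  expR ((4 + 4 * l%:R) * (n%:R / 16 ^+ l)) :> R.
Proof.
pose th : R := (16 ^+ l)^-1; pose m := n%:R * th.
have th0 : 0 < th by rewrite invr_gt0 exprn_gt0.
have sixteen : 16 <= expR 4 :> R.
  have -> : expR 4 = expR 1 ^+ 4 :> R by rewrite -expRM_natl mulr1.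
  have -> : 16 = 2 ^+ 4 :> R by rewrite -natrX.
  by apply: lerXn2r; rewrite ?nnegrE ?expR_ge0 ?expR1_ge2.
have thV : th^-1 <= expR (4 * l%:R) by rewrite invrK expRM_natr lerXn2r ?nnegrE ?expR_ge0.
have powS (S : {set 'I_n}) : \sum_(P : {set 'I_n} | P \subset S) 1 = 2 ^+ #|S| :> R.
  rewrite -natrX -card_powerset -sum1_card natr_sum; apply: eq_bigl => P.
  by rewrite powersetE.
apply: (@le_trans _ _ (\sum_(S : {set 'I_n}) expR (4 * l%:R * m) * (4 * th) ^+ #|S|)).
  rewrite [leLHS]big_mkcond; apply: ler_sum => S _; case: ifP => [Sm|_]; last first.
    by apply: mulr_ge0 (expR_ge0 _) (exprn_ge0 _ (mulr_ge0 (ler0n _ _) (ltW th0))).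
  under eq_bigr do rewrite powS; rewrite -[X in \sum_(_ | _) X]mul1r -mulr_suml powS -exprMn.
  rewrite (_ : 2 * 2 = 4); last by ring.
  rewrite exprMn [4 ^+ _ * _]mulrC mulrA -[leLHS]mul1r; apply: ler_wpM2r; first by rewrite exprn_ge0.
  rewrite -[leLHS](@mulVf _ (th ^+ #|S|)) ?gt_eqF ?exprn_gt0 //; apply: ler_wpM2r.
    by rewrite exprn_ge0 // ltW.
  rewrite -exprVn; apply: (@le_trans _ _ (expR (4 * l%:R) ^+ #|S|)).
    by apply: lerXn2r thV; rewrite ?nnegrE ?expR_ge0 // invr_ge0 ltW.
  rewrite -expRM_natr ler_expR; apply: ler_wpM2l => //; by rewrite mulr_ge0.
rewrite -mulr_sumr sum_expn_card card_ord.
have h : (1 + 4 * th) ^+ n <= expR (4 * m).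
  rewrite /m mulrCA expRM_natl; apply: lerXn2r; rewrite ?nnegrE ?expR_ge0 ?expR_ge1Dx //.
  by rewrite addr_ge0 ?mulr_ge0 // ltW.
apply: le_trans (ler_wpM2l (expR_ge0 _) h) _.
by rewrite -expRD ler_expR -/m -mulrDl addrC.
Qed.

(** One violated cut bound already makes this at least 1. The sets [P] and [Q] of positive signs
    stay inside [S], which keeps the number of terms exponential in [#|S|] rather than in [n]. *)
Definition level_moment {R : realType} {n : nat} (p t a : R) (l : nat) (E : graph n) : R :=
  \sum_(S : {set 'I_n} | #|S|%:R <= n%:R / 16 ^+ l :> R)
  \sum_(P : {set 'I_n} | P \subset S) \sum_(Q : {set 'I_n} | Q \subset S)
  expR (a * (\sum_(i in S) \sum_(j in S) centered p (adj E) i j * rsign (i \in P) * rsign (j \in Q)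
    - n%:R / 16 ^+ l * (t / 2 ^+ l))).

Lemma level_moment_ge0 {R : realType} {n : nat} (p t a : R) (l : nat) (E : graph n) :
  0 <= level_moment p t a l E.
Proof. by do 3!(apply: sumr_ge0 => ? _); exact: expR_ge0. Qed.

Lemma level_moment_cut_bound {R : realType} {n : nat} (p t a : R) (l : nat) (E : graph n)
    (S : {set 'I_n}) :
  0 <= a -> level_moment p t a l E < 1 -> #|S|%:R <= n%:R / 16 ^+ l :> R ->
  cut_bound p (adj E) S (n%:R / 16 ^+ l * (t / 2 ^+ l)).
Proof.
move=> a0 mom1 Sl x y; rewrite leNgt; apply/negP => big; move: mom1; rewrite ltNge => /negP; apply.
pose P := [set i in S | x i]%SET; pose Q := [set i in S | y i]%SET.
have PS : P \subset S by apply/fintype.subsetP => i; rewrite inE => /andP[].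
have QS : Q \subset S by apply/fintype.subsetP => i; rewrite inE => /andP[].
rewrite /level_moment (bigD1 S) //= (bigD1 P) //= (bigD1 Q) //= -!addrA ler_wpDr //.
  by apply: addr_ge0; [|apply: addr_ge0]; do 3?(apply: sumr_ge0 => ? _); exact: expR_ge0.
rewrite -[leLHS]expR0 ler_expR; apply: mulr_ge0 => //; rewrite subr_ge0.
apply: le_trans (ltW big) _.
apply: ler_sum => i iS; apply: ler_sum => j jS.
by rewrite !inE iS jS.
Qed.

(* Chernoff's bound with exponent [a = 8 L / t]: there are at most [expR (L * m)] triples
   [(S, P, Q)] with [#|S| <= m], and each of them contributes at most [expR (- 4 L * m)]. *)
Lemma level_moment_le {R : realType} {n : nat} (p s : R) (l : nat) :
  0 <= p <= 1 -> 0 < s -> s ^+ 2 = n%:R * p -> 16 ^+ l <= s ->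
  exists2 a : R, 0 <= a &
    gnp_E p (@level_moment R n p (128 * s) a l) <= expR (- (12 * (n%:R / 16 ^+ l))) :> R.
Proof.
move=> p01 s0 s2 ls; have /andP[p0 _] := p01.
pose L : R := 4 + 4 * l%:R; pose t := 128 * s / 2 ^+ l; pose m : R := n%:R / 16 ^+ l.
have L4 : 4 <= L by rewrite /L lerDl mulr_ge0.
have m0 : 0 <= m by rewrite divr_ge0 ?exprn_ge0.
have t0 : 0 < t by apply: divr_gt0; [apply: mulr_gt0; rewrite ?ltr0n|rewrite exprn_gt0 ?ltr0n].
have l8 : 1 + l%:R <= 8 ^+ l :> R.
  by rewrite addrC natr1 -natrX ler_nat; elim: (l) => // k; rewrite expnS; move: (_ ^ k)%N => b; lia.
(* This bound gives [a <= 1 / 4]; it is where [16 ^ l <= s] enters. *)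
have t32 : 32 * L <= t.
  have -> : 32 * L = 128 * (1 + l%:R) by rewrite /L; ring.
  rewrite /t -mulrA; apply: ler_wpM2l; first by rewrite ler0n.
  apply: le_trans l8 _.
  rewrite ler_pdivlMr ?exprn_gt0 // -exprMn; apply: le_trans ls.
  by rewrite (_ : 8 * 2 = 16) //; ring.
(* This bound makes the quadratic term of the moment at most half of the gain [a m t = 8 L m]. *)
have t64 : 64 * L * p * m <= t ^+ 2.
  have -> : 64 * L * p * m = 256 * ((1 + l%:R) * (s ^+ 2 / 16 ^+ l)) by rewrite /L /m s2; ring.
  have -> : t ^+ 2 = 256 * (64 * (s ^+ 2 / 4 ^+ l)).
    rewrite /t exprMn exprVn exprMn -exprM mulnC exprM (_ : 2 ^+ 2 = 4) -?natrX //; ring.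
  apply: ler_wpM2l; first by rewrite ler0n.
  have -> : (16 ^+ l)^-1 = (4 ^+ l)^-1 * (4 ^+ l)^-1 :> R.
    by rewrite -invfM -exprMn (_ : 4 * 4 = 16) //; ring.
  have l4 : (1 + l%:R) * (4 ^+ l)^-1 <= 1 :> R.
    rewrite ler_pdivrMr ?exprn_gt0 // mul1r addrC natr1 -natrX ler_nat.
    by elim: (l) => // k; rewrite expnS; move: (_ ^ k)%N => b; lia.
  have sb : 0 <= s ^+ 2 * (4 ^+ l)^-1 by rewrite mulr_ge0 ?sqr_ge0 ?invr_ge0 ?exprn_ge0.
  have := ler_wpM2r sb l4; move: (4 ^+ l)^-1 sb => b; lra.
pose a := 8 * L / t; have a0 : 0 <= a by rewrite divr_ge0 ?ltW // mulr_gt0 //; lra.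
have at8 : a * t = 8 * L by rewrite /a divfK // gt_eqF.
have a4 : 0 <= a <= 1 / 4.
  rewrite a0 /a ler_pdivrMr //; lra.
exists a => //; rewrite /level_moment.
have term (S P Q : {set 'I_n}) : #|S|%:R <= m -> gnp_E p (fun E : graph n => expR (a * (\sum_(i in S) \sum_(j in S)
    centered p (adj E) i j * rsign (i \in P) * rsign (j \in Q) - m * t))) <= expR (- (4 * L * m)).
  move=> Sm.
  have -> : gnp_E p (fun E : graph n => expR (a * (\sum_(i in S) \sum_(j in S)
      centered p (adj E) i j * rsign (i \in P) * rsign (j \in Q) - m * t))) =
    expR (- (8 * L * m)) * gnp_E p (fun E : graph n => expR (a * (\sum_(i in S) \sum_(j in S)
      centered p (adj E) i j * rsign (i \in P) * rsign (j \in Q)))).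
    rewrite -gnp_EZ; apply: eq_bigr => E _; rewrite -expRD -at8; congr (_ * expR _); ring.
  have s1 (U : {set 'I_n}) i : `|rsign (i \in U) : R| <= 1.
    by rewrite /rsign; case: ifP; rewrite ?normrN normr1.
  have := cut_mgf p a (fun i => rsign (i \in P)) (fun i => rsign (i \in Q)) S p01 a4 (s1 P) (s1 Q).
  move/(ler_wpM2l (expR_ge0 (- (8 * L * m)))) => mgf.
  apply: le_trans mgf _.
  rewrite -expRD ler_expR.
  have Sm2 : #|S|%:R ^+ 2 <= m ^+ 2 by apply: lerXn2r; rewrite ?nnegrE.
  have : 4 * a ^+ 2 * p * #|S|%:R ^+ 2 <= 4 * a ^+ 2 * p * m ^+ 2.
    by apply: ler_wpM2l => //; apply: mulr_ge0 => //; apply: mulr_ge0; rewrite ?sqr_ge0 ?ler0n.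
  suff : 4 * a ^+ 2 * p * m ^+ 2 <= 4 * L * m by lra.
  have aL : a * (64 * L * p * m) <= a * t * t by rewrite -[leRHS]mulrA -expr2; apply: ler_wpM2l.
  rewrite at8 in aL.
  have L0 : 0 < L by lra.
  have t1 : 8 * (a * p * m) <= t.
    rewrite -(ler_pM2l (_ : 0 < 8 * L)); last by lra.
    by move: aL; lra.
  have : a * m * (8 * (a * p * m)) <= a * m * t by apply: ler_wpM2l => //; exact: mulr_ge0.
  have -> : a * m * t = 8 * L * m by rewrite mulrAC at8.
  have -> : a * m * (8 * (a * p * m)) = 2 * (4 * a ^+ 2 * p * m ^+ 2) by ring.
  lra.
rewrite gnp_E_sum.
apply: (@le_trans _ _ (\sum_(S : {set 'I_n} | #|S|%:R <= m) \sum_(P : {set 'I_n} | P \subset S)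
   \sum_(Q : {set 'I_n} | Q \subset S) 1 * expR (- (4 * L * m)))).
  apply: ler_sum => S Sm; rewrite gnp_E_sum; apply: ler_sum => P _.
  by rewrite gnp_E_sum; apply: ler_sum => Q _; rewrite mul1r; exact: term.
under eq_bigr do under eq_bigr do rewrite -mulr_suml.
under eq_bigr do rewrite -mulr_suml; rewrite -mulr_suml.
apply: le_trans (ler_wpM2r (expR_ge0 _) (count_level_cuts l)) _.
rewrite -expRD ler_expR -/m -/L; have : 0 <= (L - 4) * m by rewrite mulr_ge0 // subr_ge0.
lra.
Qed.

(** * Sparsity of small vertex sets *)

(** The Chernoff exponent. Its exponential is [e n / (s #|S|)], so by [n p = s^2] the moment of the
    edge count costs only [e s #|S| / 2] in the exponent, while the gain keeps the logarithm needed
    against the number of sets. *)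
Definition edge_excess_rate {R : realType} {n : nat} (s : R) (S : {set 'I_n}) : R :=
  1 + ln (n%:R / (s * #|S|%:R)).

(** The empty set is excluded because its term would be 1. *)
Definition sparsity_moment {R : realType} {n : nat} (s : R) (E : graph n) : R :=
  \sum_(S : {set 'I_n} | (S != finset.set0) && (#|S|%:R <= n%:R / s :> R))
  expR (edge_excess_rate s S / 2 *
    (\sum_(i in S) \sum_(j in S) (adj E i j)%:R - 12 * s * #|S|%:R)).

Lemma sparsity_moment_ge0 {R : realType} {n : nat} (s : R) (E : graph n) :
  0 <= sparsity_moment s E.
Proof. by apply: sumr_ge0 => ? _; exact: expR_ge0. Qed.

Lemma edge_excess_rate_ge1 {R : realType} {n : nat} (s : R) (S : {set 'I_n}) :
  0 < s -> S != finset.set0 -> #|S|%:R <= n%:R / s :> R -> 1 <= edge_excess_rate s S.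
Proof.
move=> s0 S0 Sn; rewrite lerDl; apply: ln_ge0.
have S1 : 0 < #|S|%:R :> R by rewrite ltr0n card_gt0.
by rewrite ler_pdivlMr ?mulr_gt0 // mul1r mulrC -ler_pdivlMr.
Qed.

Lemma sparsity_moment_lt1 {R : realType} {n : nat} (s : R) (E : graph n) (S : {set 'I_n}) :
  0 < s -> sparsity_moment s E < 1 -> S != finset.set0 -> #|S|%:R <= n%:R / s :> R ->
  \sum_(i in S) \sum_(j in S) (adj E i j)%:R <= 12 * s * #|S|%:R :> R.
Proof.
move=> s0 mom1 S0 Sn; rewrite leNgt; apply/negP => big; move: mom1; rewrite ltNge => /negP; apply.
rewrite /sparsity_moment (bigD1 S) /=; last by rewrite S0.
rewrite ler_wpDr //; first by apply: sumr_ge0 => ? _; exact: expR_ge0.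
rewrite -[leLHS]expR0 ler_expR; apply: mulr_ge0; last by rewrite subr_ge0 ltW.
have := edge_excess_rate_ge1 s S s0 S0 Sn; lra.
Qed.

(* The function [u (1 + ln (n / u))] is increasing on [1, n]. *)
Lemma mul_ln_ratio_ge {R : realType} (n u : R) : 1 <= u -> u <= n ->
  1 + ln n <= u * (1 + ln (n / u)).
Proof.
move=> u1 un; have u0 : 0 < u by lra.
have n0 : 0 < n by lra.
rewrite ln_div ?posrE //.
have b1 : ln u <= u - 1 by have := @le_ln1Dx R (u - 1); rewrite subrKC; apply; lra.
have ab : ln u <= ln n by rewrite ler_ln ?posrE.
move: (ln u) (ln n) b1 ab => b a b1 ab; nra.
Qed.

(* The exponent is about [- 4 u (1 + ln (n / u))] with [u = s #|S|]. One half of it yields the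
   factor [n ^- 2], the other half outweighs the number of sets of size [#|S|]. *)
Lemma sparsity_moment_term {R : realType} {n : nat} (p s : R) (S : {set 'I_n}) :
  0 <= p <= 1 -> 1 <= s -> s ^+ 2 = n%:R * p -> S != finset.set0 -> #|S|%:R <= n%:R / s :> R ->
  gnp_E p (fun E : graph n => expR (edge_excess_rate s S / 2 *
    (\sum_(i in S) \sum_(j in S) (adj E i j)%:R - 12 * s * #|S|%:R))) <=
  n%:R ^- 2 * (expR (- #|S|%:R) * (#|S|%:R / n%:R) ^+ #|S|).
Proof.
move=> p01 s1 s2 S0 Sn; have s0 : 0 < s by lra.
have /andP[p0 _] := p01.
have lam1 := edge_excess_rate_ge1 s S s0 S0 Sn.
set m : R := #|S|%:R; have m1 : 1 <= m by rewrite ler1n card_gt0.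
have m0 : 0 < m by lra.
have un : s * m <= n%:R by rewrite mulrC -ler_pdivlMr.
have u1 : 1 <= s * m by nra.
have n0 : 0 < n%:R :> R by lra.
have nn : n%:R != 0 :> R by rewrite gt_eqF.
set lam := edge_excess_rate s S in lam1 *.
have lamE : lam = 1 + ln (n%:R / (s * m)) by [].
have -> : gnp_E p (fun E : graph n => expR (lam / 2 *
    (\sum_(i in S) \sum_(j in S) (adj E i j)%:R - 12 * s * m))) =
  expR (- (6 * lam * (s * m))) * gnp_E p (fun E : graph n => expR (lam / 2 *
    \sum_(i in S) \sum_(j in S) (adj E i j)%:R)).
  by rewrite -gnp_EZ; apply: eq_bigr => E _; rewrite -expRD; congr (_ * expR _); field.
have lam0 : 0 <= lam by lra.
have mgf := edge_count_mgf p lam S p01 lam0.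
apply: le_trans (ler_wpM2l (expR_ge0 _) mgf) _; rewrite -expRD -/m.
have explam : p * expR lam * m ^+ 2 / 2 <= 2 * (s * m).
  have -> : expR lam = expR 1 * (n%:R / (s * m)).
    by rewrite lamE expRD lnK // posrE divr_gt0 // mulr_gt0.
  have -> : p * (expR 1 * (n%:R / (s * m))) * m ^+ 2 / 2 = expR 1 * ((n%:R * p) / s * m / 2).
    by field; rewrite !gt_eqF.
  rewrite -s2 expr2 mulfK ?gt_eqF //; have := @expR1_le4 R; nra.
apply: (@le_trans _ _ (expR (- (2 * (lam * (s * m)))) * expR (- (2 * (lam * (s * m)))))).
  rewrite -expRD ler_expR.
  have : s * m <= lam * (s * m) by rewrite -[leLHS]mul1r; apply: ler_wpM2r => //; lra.
  move: explam; rewrite -[6 * lam * _]mulrA; lra.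
apply: ler_pM; rewrite ?expR_ge0 //.
  have -> : n%:R ^- 2 = expR (- (2 * ln n%:R)) :> R.
    by rewrite expRN expRM_natl lnK.
  rewrite ler_expR lerN2; apply: ler_wpM2l => //.
  have := mul_ln_ratio_ge n%:R (s * m) u1 un; rewrite -lamE; lra.
have -> : (m / n%:R) ^+ #|S| = expR (ln (m / n%:R) * m).
  by rewrite expRM_natr lnK // posrE divr_gt0.
rewrite -expRD ler_expR.
have lnE : ln (n%:R / (s * m)) = - ln (m / n%:R) - ln s.
  rewrite !ln_div ?lnM ?posrE ?mulr_gt0 //; ring.
have lns : ln s <= s by have := @le_ln1Dx R (s - 1); rewrite subrKC => h; have : ln s <= s - 1 by [apply: h; lra]; lra.
(* The rate has [ln (n / (s m))] where counting sets needs [ln (n / m)]; the missing [ln s] is paid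
   by the factor [s] in [s * m]. *)
have h1 : m * lam <= lam * (s * m).
  by rewrite mulrC; apply: ler_wpM2l => //; rewrite -[leLHS]mul1r; apply: ler_wpM2r => //; lra.
have h2 : m * ln s <= lam * (s * m).
  apply: (@le_trans _ _ (m * s)); first by apply: ler_wpM2l => //; lra.
  by rewrite [m * s]mulrC -[leLHS]mul1r; apply: ler_wpM2r => //; lra.
have h3 : m * (lam + ln s) = m - ln (m / n%:R) * m by rewrite lamE lnE; ring.
rewrite mulrDr in h3; lra.
Qed.

(** Binomial coefficients are avoided by summing over all [S] for each possible size [k]: the sum of
    [(k / n) ^ #|S|] is [(1 + k / n) ^ n <= exp k], which cancels [exp (- k)]. The [n + 1] values of
    [k] leave [(n + 1) / n^2]. *)
Lemma sparsity_moment_le {R : realType} {n : nat} (p s : R) :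
  0 <= p <= 1 -> 1 <= s -> s ^+ 2 = n%:R * p -> (0 < n)%N ->
  gnp_E p (@sparsity_moment R n s) <= 2 / n%:R.
Proof.
move=> p01 s1 s2 n0; have n0' : 0 < n%:R :> R by rewrite ltr0n.
rewrite gnp_E_sum.
apply: (@le_trans _ _ (\sum_(S : {set 'I_n}) \sum_(k < n.+1)
   n%:R ^- 2 * (expR (- k%:R) * (k%:R / n%:R) ^+ #|S|))).
  have pos (S : {set 'I_n}) (k : 'I_n.+1) :
      0 <= n%:R ^- 2 * (expR (- k%:R) * (k%:R / n%:R) ^+ #|S|) :> R.
    by rewrite mulr_ge0 ?invr_ge0 ?exprn_ge0 // mulr_ge0 ?expR_ge0 ?exprn_ge0 // divr_ge0.
  rewrite [leLHS]big_mkcond; apply: ler_sum => S _; case: ifP => [/andP[S0 Sn]|_]; last first.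
    by apply: sumr_ge0 => k _; exact: pos.
  apply: le_trans (sparsity_moment_term p s S p01 s1 s2 S0 Sn) _.
  have Sk : (#|S| < n.+1)%N by rewrite ltnS -[leqRHS](card_ord n) max_card.
  rewrite (bigD1 (Ordinal Sk)) //= lerDl; apply: sumr_ge0 => k _; exact: pos.
rewrite exchange_big /=.
apply: (@le_trans _ _ (\sum_(k < n.+1) n%:R ^- 2)).
  apply: ler_sum => k _; rewrite -!mulr_sumr sum_expn_card card_ord.
  rewrite -[leRHS]mulr1; apply: ler_wpM2l; first by rewrite invr_ge0 exprn_ge0.
  rewrite expRN mulrC ler_pdivrMr ?expR_gt0 // mul1r.
  have {2}-> : k%:R = n%:R * (k%:R / n%:R) :> R by rewrite mulrCA divff ?mulr1 // gt_eqF.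
  rewrite expRM_natl; apply: lerXn2r; rewrite ?nnegrE ?expR_ge0 ?expR_ge1Dx //.
rewrite sumr_const card_ord -[_ *+ n.+1]mulr_natl -natr1 expr2 invfM mulrA.
apply: ler_wpM2r; first by rewrite invr_ge0 ltW.
rewrite mulrDl divff ?gt_eqF // mul1r.
have : n%:R^-1 <= 1 :> R by rewrite invf_le1 // ler1n.
lra.
Qed.

(** * Vector chromatic numbers of random graphs *)

(** The bound [N <= s] serves to absorb the summand [N] of the peeling. *)
Lemma exists_last_level {R : realType} (s : R) : 0 <= s ->
  exists N : nat, [/\ s < 16 ^+ N, forall l, (l < N)%N -> 16 ^+ l <= s & N%:R <= s].
Proof.
move=> s0.
have exN : exists N : nat, s < 16 ^+ N.
  exists (Num.truncn s).+1; apply: (@lt_le_trans _ _ (Num.truncn s).+1%:R).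
    exact: truncnS_gt.
  by rewrite -natrX ler_nat ltnW // ltn_expl.
pose P N := s < 16 ^+ N; case: (@ex_minnP P exN) => N sN Nmin.
have below l : (l < N)%N -> 16 ^+ l <= s.
  by move=> lN; rewrite leNgt; apply/negP => /Nmin; rewrite leqNgt lN.
exists N; split=> //; case: N sN Nmin below => // N _ _ below.
apply: le_trans (below N (ltnSn N)).
by rewrite -natrX ler_nat ltn_expl.
Qed.

Lemma low_degree_vertex {R : realType} {n : nat} (E : graph n) (T : {set 'I_n}) (b : R) :
  0 <= b -> T != finset.set0 ->
  \sum_(i in T) \sum_(j in T) (adj E i j)%:R <= b * #|T|%:R ->
  exists2 i, i \in T & (#|[set j in T | adj E i j]%SET| <= Num.truncn b)%N.
Proof.
move=> b0 T0 Tb.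
have [/existsP[i /andP[iT di]]|] :=
  boolP [exists i, (i \in T) && (#|[set j in T | adj E i j]%SET| <= Num.truncn b)%N].
  by exists i.
rewrite negb_exists => /forallP high; exfalso; move: Tb; apply/negP; rewrite -ltNge.
rewrite -sumr_const mulr_sumr; under eq_bigr do rewrite mulr1.
have [i0 i0T] := set0Pn _ T0.
have deg i : i \in T -> b < \sum_(j in T) (adj E i j)%:R.
  move=> iT; have := high i; rewrite iT /= -ltnNge => di.
  rewrite -natr_sum; apply: (@lt_le_trans _ _ (Num.truncn b).+1%:R); first exact: truncnS_gt.
  rewrite ler_nat (leq_trans di) // -sum1_card big_mkcond [leqRHS]big_mkcond /=.
  by apply: leq_sum => j _; rewrite inE; case: (j \in T) => //=; case: (adj E i j).
rewrite (bigD1 i0) //= [ltRHS](bigD1 i0) //=; apply: ltr_leD; first exact: deg.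
by apply: ler_sum => i /andP[iT _]; apply: ltW; exact: deg.
Qed.

(* [s] stands for [sqrt (n p)]. *)
Definition level_cut_bounds {R : realType} {n : nat} (p s : R) (E : graph n) : Prop :=
  forall l (S : {set 'I_n}), 16 ^+ l <= s -> #|S|%:R <= n%:R / 16 ^+ l :> R ->
  cut_bound p (adj E) S (n%:R / 16 ^+ l * (128 * s / 2 ^+ l)).

Lemma theta_bar_half_lower {R : realType} {n : nat} (p s : R) (E : graph n) :
  (1 < n)%N -> 0 <= p <= 1 -> 512 <= s -> s ^+ 2 = n%:R * p ->
  cut_bound p (adj E) [set: 'I_n]%SET (n%:R * (128 * s)) ->
  (400 * 200)^-1 * s <= theta_bar_half R E.
Proof.
move=> n1 /andP[p0 p1] s1 s2 cutE; apply: theta_bar_half_ge => // k v k1 vE.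
have := vector_coloring_bound p (128 * s) k E v (ltnW n1) p0 k1 vE cutE.
rewrite mulrBr mulr1 [p * n%:R]mulrC -s2 => key.
have h : (k - 1) * (p + 98 * (128 * s)) <= (k - 1) * (200 * (100 * s)).
  apply: ler_wpM2l; lra.
have s0 : 0 < s by lra.
(* Hence the error [p + 128 * s] is at most half of the main term [s ^ 2]. *)
have s512 : 512 * s <= s * s by rewrite ler_pM2r.
have : s * (s / 2) <= s * (200 * 100 * (k - 1)) by rewrite expr2 in key; lra.
rewrite ler_pM2l // => key2; rewrite [leLHS]mulrC ler_pdivrMr; last by rewrite mulr_gt0 ?ltr0n.
lra.
Qed.

Lemma theta_half_lower {R : realType} {n : nat} (p s : R) (E : graph n) :
  (1 < n)%N -> 0 <= p <= 1 / 2 -> 512 <= s -> s ^+ 2 = n%:R * p ->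
  cut_bound p (adj E) [set: 'I_n]%SET (n%:R * (128 * s)) ->
  (400 * 200)^-1 * (n%:R / s) <= theta_half R E.
Proof.
move=> n1 /andP[p0 p1] s1 s2 /cut_bound_compl cutE; apply: theta_bar_half_ge => // k v k1 vE.
have q0 : 0 <= 1 - p by lra.
have := vector_coloring_bound (1 - p) (128 * s) k _ v (ltnW n1) q0 k1 vE cutE => key.
have h : (k - 1) * ((1 - p) + 98 * (128 * s)) <= (k - 1) * (200 * (100 * s)).
  apply: ler_wpM2l; lra.
have s0 : 0 < s by lra.
have s512 : 512 * s <= s * s by rewrite ler_pM2r.
(* With [512 <= s] this gives [n >= 1024 s], which makes [128 * s] small against [(n - 1) / 2]. *)
have n2 : 2 * (s * s) <= n%:R.
  have : n%:R * p <= n%:R * (1 / 2) by apply: ler_wpM2l.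
  rewrite -s2 expr2; lra.
have half : 1 / 2 * (n%:R - 1) <= (1 - p) * (n%:R - 1).
  by apply: ler_wpM2r; [rewrite subr_ge0 ler1n ltnW|lra].
rewrite mulrA ler_pdivrMr // [leLHS]mulrC ler_pdivrMr; last by rewrite mulr_gt0 ?ltr0n.
lra.
Qed.

Lemma theta_bar_2_upper {R : realType} {n : nat} (p s : R) (E : graph n) :
  0 < p <= 1 / 2 -> 1 <= s -> s ^+ 2 = n%:R * p -> level_cut_bounds p s E ->
  (forall S : {set 'I_n}, S != finset.set0 -> #|S|%:R <= n%:R / s :> R ->
     \sum_(i in S) \sum_(j in S) (adj E i j)%:R <= 12 * s * #|S|%:R :> R) ->
  theta_bar_2 R E <= 1000 * 1000 * s.
Proof.
move=> /andP[p0 p1] s1 s2 lev sparse; have s0 : 0 < s by lra.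
have [N [sN Ns Nle]] := exists_last_level s (ltW s0).
have b0 : 0 <= 12 * s by lra.
have cert : rigid_certificate (adj E) [set: 'I_n]%SET
    ((Num.truncn (12 * s)).+1%:R + N%:R + 32 * (98 * (128 * s / (1 - p)))).
  apply: rigid_certificate_peeling => //.
  - exact: adj_irr.
  - exact: adj_sym.
  - by lra.
  - by apply: mulr_gt0; rewrite ?ltr0n.
  - by move=> l S lN; apply: lev; exact: Ns.
  - move=> S SN.
    have [|c [cD hc]] := degenerate_coloring (adj E) (Num.truncn (12 * s)) S (adj_irr E) (adj_sym E).
      move=> T TS T0; apply: low_degree_vertex => //; apply: sparse => //.
      apply: (@le_trans _ _ #|S|%:R); first by rewrite ler_nat subset_leq_card.
      apply: le_trans SN _; apply: ler_wpM2l => //.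
      by rewrite lef_pV2 ?posrE ?exprn_gt0 ?ltr0n // ltW.
    exact: (rigid_certificate_coloring _ _ _ c).
have D12 : (Num.truncn (12 * s))%:R <= 12 * s by rewrite truncn_le.
(* The spectral parts thus cost at most [32 * 98 * 128 * 2 = 802816] times [s]. *)
have inv2 : (1 - p)^-1 <= 2.
  rewrite -[leRHS]invrK lef_pV2 ?posrE ?invr_gt0 ?ltr0n //; lra.
have si : s * (1 - p)^-1 <= s * 2 by apply: ler_wpM2l => //; lra.
have si0 : 0 < s * (1 - p)^-1 by apply: mulr_gt0 => //; rewrite invr_gt0; lra.
have N0 : 0 <= N%:R :> R by rewrite ler0n.
have D0 : 0 <= (Num.truncn (12 * s))%:R :> R by rewrite ler0n.
apply: le_trans (theta_bar_2_le _ _ _ cert) _; rewrite -natr1 -[128 * s / _]mulrA; lra.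
Qed.

Lemma theta_2_upper {R : realType} {n : nat} (p s : R) (E : graph n) :
  0 < p <= 1 / 2 -> 1 <= s -> s ^+ 2 = n%:R * p -> level_cut_bounds p s E ->
  theta_2 R E <= 1000 * 1000 * (n%:R / s).
Proof.
move=> /andP[p0 p1] s1 s2 lev; have s0 : 0 < s by lra.
have [N [sN Ns Nle]] := exists_last_level s (ltW s0).
have ns : s <= n%:R / s.
  rewrite ler_pdivlMr // -expr2 s2 -[leRHS]mulr1; apply: ler_wpM2l => //; lra.
(* The complement is centered at [q = 1 - p], so the factor [t / (1 - q)] of the peeling is
   [128 s / p], of the order of the target. *)
have sp : s / p = n%:R / s.
  have -> : n%:R = s ^+ 2 / p by rewrite s2 mulfK // gt_eqF.
  by field; rewrite !gt_eqF.
have ns0 : 0 <= n%:R / s by lra.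
have cert : rigid_certificate (adj (compl_graph E)) [set: 'I_n]%SET
    ((Num.truncn (n%:R / s)).+1%:R + N%:R + 32 * (98 * (128 * s / (1 - (1 - p))))).
  apply: rigid_certificate_peeling => //.
  - exact: adj_irr.
  - exact: adj_sym.
  - by lra.
  - by apply: mulr_gt0; rewrite ?ltr0n.
  - by move=> l S lN Sl; apply: cut_bound_compl; apply: lev => //; exact: Ns.
  - move=> S SN; apply: (rigid_certificate_coloring _ _ _ (fun i => index i (enum S))).
      move=> i iS; have iS' : i \in enum S by rewrite mem_enum.
      rewrite truncn_ge_nat //; apply: le_trans (le_trans SN _).
        by rewrite ler_nat cardE ltnW // index_mem.
      by apply: ler_wpM2l => //; rewrite lef_pV2 ?posrE ?exprn_gt0 ?ltr0n // ltW.
    move=> i j iS jS; apply: contraTneq => ij.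
    have -> : i = j by rewrite -(nth_index i (_ : i \in enum S)) ?mem_enum // ij nth_index ?mem_enum.
    by rewrite adj_irr.
have Dns : (Num.truncn (n%:R / s))%:R <= n%:R / s by rewrite truncn_le.
have N0 : 0 <= N%:R :> R by rewrite ler0n.
have D0 : 0 <= (Num.truncn (n%:R / s))%:R :> R by rewrite ler0n.
rewrite subKr -[128 * s / p]mulrA sp -natr1 in cert.
apply: le_trans (theta_bar_2_le _ _ _ cert) _; lra.
Qed.

(** Up to the last level [n / 16 ^ l >= n / s >= sqrt n], so the exponential is below any fixed
    power of [n]; the power -2 survives a union over at most [n] levels. *)
Lemma exp_level_le {R : realType} {n : nat} (p s : R) (l : nat) :
  (0 < n)%N -> p <= 1 -> 0 < s -> s ^+ 2 = n%:R * p -> 16 ^+ l <= s ->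
  expR (- (12 * (n%:R / 16 ^+ l))) <= n%:R ^- 2 :> R.
Proof.
move=> n0 p1 s0 s2 ls; have n0' : 0 < n%:R :> R by rewrite ltr0n.
set y := n%:R / 16 ^+ l.
have yns : n%:R / s <= y by apply: ler_wpM2l => //; rewrite lef_pV2 ?posrE ?exprn_gt0 ?ltr0n.
have y0 : 0 <= y by apply: le_trans yns; rewrite divr_ge0 // ltW.
have ny : n%:R <= y ^+ 2.
  apply: (@le_trans _ _ ((n%:R / s) ^+ 2)).
    rewrite exprMn exprVn ler_pdivlMr ?exprn_gt0 // s2 expr2; apply: ler_wpM2l => //.
    by rewrite -[leRHS]mulr1; apply: ler_wpM2l.
  by apply: lerXn2r; rewrite ?nnegrE // divr_ge0 // ltW.
rewrite expRN lef_pV2 ?posrE ?expR_gt0 ?exprn_gt0 //.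
have -> : 12 * y = 4%:R * (3 * y) by rewrite mulrA -natrM.
rewrite expRM_natl; apply: (@le_trans _ _ (y ^+ 4)).
  rewrite (_ : y ^+ 4 = (y ^+ 2) ^+ 2); last by rewrite -exprM.
  by apply: lerXn2r; rewrite ?nnegrE ?exprn_ge0.
apply: lerXn2r; rewrite ?nnegrE ?expR_ge0 //.
have := @expR_ge1Dx R (3 * y); lra.
Qed.

Lemma gnp_level_cut_bounds {R : realType} {n : nat} (p s : R) :
  (0 < n)%N -> 0 <= p <= 1 -> 0 < s -> s ^+ 2 = n%:R * p -> s <= n%:R ->
  exists F : graph n -> R, [/\ forall E, 0 <= F E, gnp_E p F <= n%:R^-1 &
    forall E, F E < 1 -> level_cut_bounds p s E].
Proof.
move=> n0 p01 s0 s2 sn; have n0' : 0 < n%:R :> R by rewrite ltr0n.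
have /choice[a ha] : forall l, exists a : R, 16 ^+ l <= s -> 0 <= a /\
    gnp_E p (@level_moment R n p (128 * s) a l) <= expR (- (12 * (n%:R / 16 ^+ l))).
  move=> l; case: (boolP (16 ^+ l <= s)) => [ls|]; last by exists 0.
  by have [a a0 ale] := level_moment_le (n := n) p s l p01 s0 s2 ls; exists a.
pose F E := \sum_(l < n | 16 ^+ l <= s) @level_moment R n p (128 * s) (a l) l E.
exists F; split=> [E||E FE l S ls].
- by apply: sumr_ge0 => l _; exact: level_moment_ge0.
- rewrite gnp_E_sum; apply: (@le_trans _ _ (\sum_(l < n) n%:R ^- 2)).
    rewrite [leLHS]big_mkcond; apply: ler_sum => l _; case: ifP => ls.
      apply: le_trans (proj2 (ha l ls)) _; apply: exp_level_le s2 ls => //.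
      by case/andP: p01.
    by rewrite invr_ge0 exprn_ge0.
  rewrite sumr_const card_ord -[_ *+ n]mulr_natl expr2 invfM mulrA divff ?mul1r //.
  by rewrite gt_eqF.
(* All relevant levels occur in the finite sum [F], since [l < 16 ^ l <= s <= n]. *)
- have ln : (l < n)%N.
    rewrite -(ltr_nat R); apply: lt_le_trans sn; apply: lt_le_trans ls.
    by rewrite -natrX ltr_nat ltn_expl.
  apply: level_moment_cut_bound; first exact: (proj1 (ha l ls)).
  apply: le_lt_trans FE; rewrite /F (bigD1 (Ordinal ln)) //= lerDl.
  by apply: sumr_ge0 => k _; exact: level_moment_ge0.
Qed.

Local Open Scope classical_set_scope.

Theorem theorem4 (R : realType) :
  exists c0 : R, 0 < c0 /\
  exists c1 c2 c3 c4 : R, [/\ 0 < c1, 0 < c2, 0 < c3 & 0 < c4] /\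
  forall p : nat -> R,
    (exists N : nat, forall n : nat, (N <= n)%N ->
       c0 / n%:R <= p n /\ p n <= 1 / 2) ->
    (fun n : nat =>
       gnp_prob (p n) [pred E : graph n |
         [&& c1 * Num.sqrt (n%:R / p n) <= @theta_half R n E,
             @theta_half R n E <= @theta R n E,
             @theta R n E <= @theta_2 R n E,
             @theta_2 R n E <= c2 * Num.sqrt (n%:R / p n),
             c3 * Num.sqrt (n%:R * p n) <= @theta_bar_half R n E,
             @theta_bar_half R n E <= @theta_bar R n E,
             @theta_bar R n E <= @theta_bar_2 R n E &
             @theta_bar_2 R n E <= c4 * Num.sqrt (n%:R * p n)]])
      @ \oo --> (1 : R)
    /\
    (exists N : nat, forall n : nat, (N <= n)%N ->
       gnp_prob (p n) [pred E : graph n |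
         [&& c3 * Num.sqrt (n%:R * p n) <= @theta_bar_half R n E,
             @theta_bar_half R n E <= @theta_bar R n E &
             @theta_bar R n E <= @theta_bar_2 R n E]]
       >= 1 - expR (- n%:R)).
Proof.
pose c : R := (400 * 200)^-1; pose C : R := 1000 * 1000.
have c_gt0 : 0 < c by rewrite invr_gt0 mulr_gt0 ?ltr0n.
have C_gt0 : 0 < C by rewrite mulr_gt0 ?ltr0n.
(* This makes [s = sqrt (n p)] at least 512, as the lower bounds require. *)
exists (512 * 512); split; first by rewrite mulr_gt0 ?ltr0n.
exists c, C, c, C; split=> [//|p [N1 hp]].
pose s n := Num.sqrt (n%:R * p n).
have setup n : (maxn N1 1 <= n)%N -> [/\ 0 < p n <= 1 / 2, 512 <= s n, s n ^+ 2 = n%:R * p n,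
    (1 < n)%N & Num.sqrt (n%:R / p n) = n%:R / s n].
  rewrite geq_max => /andP[Nn n0]; have n0' : 0 < n%:R :> R by rewrite ltr0n.
  have [lo hi] := hp n Nn; rewrite ler_pdivrMr // in lo.
  have c00 : 0 < 512 * 512 :> R by rewrite mulr_gt0 ?ltr0n.
  have np0 : 0 < p n * n%:R by exact: lt_le_trans lo.
  have p0 : 0 < p n by rewrite pmulr_lgt0 in np0.
  have s2 : s n ^+ 2 = n%:R * p n by rewrite sqr_sqrtr // mulrC ltW.
  have sge : 512 <= s n.
    rewrite -(@ler_pXn2r _ 2) ?nnegrE ?sqrtr_ge0 ?ler0n // s2 mulrC expr2; exact: lo.
  have s0 : 0 < s n by apply: lt_le_trans sge; rewrite ltr0n.
  split=> //; first by rewrite p0.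
    rewrite -(ltr_nat R); apply: (@lt_le_trans _ _ (512 * 512)); first by lra.
    apply: le_trans lo _; rewrite -[leRHS]mul1r; apply: ler_wpM2r; first exact: ltW.
    lra.
  have -> : n%:R / p n = (n%:R / s n) ^+ 2.
    by rewrite exprMn exprVn s2; field; rewrite !gt_eqF.
  by rewrite sqrtr_sqr ger0_norm // divr_ge0 // ltW.
have p01 n : 0 < p n <= 1 / 2 -> 0 <= p n <= 1 by move=> /andP[? ?]; apply/andP; split; lra.
split; last first.
  exists (maxn N1 1) => n /setup[pn sge s2 n1 _].
  have s0 : 0 < s n by apply: lt_le_trans sge; rewrite ltr0n.
  have s1 : 16 ^+ 0 <= s n by rewrite expr0; apply: le_trans sge; rewrite ler1n.
  (* The lower bound only uses the cut bound on the whole vertex set, which is level 0 and fails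
     with probability at most exp (- 12 n). *)
  have [a a0 ale] := level_moment_le (n := n) (p n) (s n) 0 (p01 n pn) s0 s2 s1.
  apply: le_trans (gnp_prob_ge (p n) _ _ (p01 n pn)
    (fun E => level_moment_ge0 (p n) (128 * s n) a 0 E) _).
    rewrite lerD2l lerN2; apply: le_trans ale _; rewrite ler_expR lerN2 expr0 divr1.
    by rewrite -[leLHS]mul1r; apply: ler_wpM2r; rewrite ?ler0n ?ler1n.
  move=> E _; apply: contraR; rewrite -ltNge => mom1 /=.
  rewrite theta_bar_half_le // theta_bar_le // !andbT.
  apply: theta_bar_half_lower (p01 n pn) sge s2 _ => //.
  have := level_moment_cut_bound (p n) (128 * s n) a 0 E [set: 'I_n]%SET a0 mom1.
  by rewrite !expr0 !divr1 cardsT card_ord; exact.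
(* The cut bounds fail with probability at most [1 / n] and sparsity with at most [2 / n]; as
   [harmonic n] is [1 / (n + 1)], the sum is at most [6 * harmonic n]. *)
apply: (@squeeze_cvgr _ _ _ _ (fun n => 1 - 6 * harmonic n) (fun=> 1)); last first.
- exact: cvg_cst.
- rewrite -[X in _ --> X]subr0 -[X in _ --> _ - X](mulr0 6).
  by apply: cvgB; [exact: cvg_cst|apply: cvgM; [exact: cvg_cst|exact: cvg_harmonic]].
near=> n.
have /setup[pn sge s2 n1 sqrtE] : (maxn N1 1 <= n)%N by near: n; exact: nbhs_infty_ge.
have s0 : 0 < s n by apply: lt_le_trans sge; rewrite ltr0n.
have s1 : 1 <= s n by apply: le_trans sge; rewrite ler1n.
have n0 : (0 < n)%N by exact: ltnW.
have n0' : 0 < n%:R :> R by rewrite ltr0n.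
have sn : s n <= n%:R.
  rewrite -(ler_pM2l s0) -expr2 s2; have : p n <= s n by case/andP: pn; lra.
  by rewrite mulrC; apply: ler_wpM2r; exact: ltW.
rewrite gnp_prob_le1 ?p01 // andbT.
have [F [F0 Fle Fgood]] := gnp_level_cut_bounds (n := n) (p n) (s n) n0 (p01 n pn) s0 s2 sn.
pose G (E : graph n) := F E + sparsity_moment (s n) E.
have G0 E : 0 <= G E by rewrite addr_ge0 ?sparsity_moment_ge0.
apply: le_trans (gnp_prob_ge (p n) _ _ (p01 n pn) G0 _).
  rewrite lerD2l lerN2.
  have -> : gnp_E (p n) G = gnp_E (p n) F + gnp_E (p n) (@sparsity_moment R n (s n)).
    by rewrite -big_split; apply: eq_bigr => E _; rewrite /G mulrDr.
  have sp := sparsity_moment_le (n := n) (p n) (s n) (p01 n pn) s1 s2 n0.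
  apply: le_trans (lerD Fle sp) _.
  have : n%:R^-1 <= 2 * n.+1%:R^-1 :> R.
    rewrite -[leLHS]mul1r ler_pdivrMr // mulrAC ler_pdivlMr ?ltr0n // mul1r -natr1.
    have : 1 <= n%:R :> R by rewrite ler1n.
    lra.
  rewrite /harmonic /=; move: (n%:R^-1) (n.+1%:R^-1) => u v; lra.
move=> E _; apply: contraR; rewrite -ltNge => G1 /=.
have F1 : F E < 1 by apply: le_lt_trans G1; rewrite lerDl sparsity_moment_ge0.
have S1 : sparsity_moment (s n) E < 1 by apply: le_lt_trans G1; rewrite lerDr.
have lev := Fgood E F1.
have cut0 : cut_bound (p n) (adj E) [set: 'I_n]%SET (n%:R * (128 * s n)).
  have := lev 0%N [set: 'I_n]%SET; rewrite !expr0 !divr1 cardsT card_ord; exact.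
have p0h : 0 <= p n <= 1 / 2 by case/andP: pn => /ltW -> ->.
rewrite sqrtE /theta_half /theta /theta_2 !theta_bar_half_le // !theta_bar_le //=.
apply/and4P; split.
- exact: (theta_half_lower (p n) (s n) E n1 p0h sge s2 cut0).
- exact: (theta_2_upper (p n) (s n) E pn s1 s2 lev).
- exact: (theta_bar_half_lower (p n) (s n) E n1 (p01 n pn) sge s2 cut0).
- apply: (theta_bar_2_upper (p n) (s n) E pn s1 s2 lev) => S S0 Sn.
  exact: sparsity_moment_lt1.
Unshelve. all: by end_near.
Qed.
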